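(* Let $T=((\Omega,\mathcal{A}),\{(\Omega,\mathcal{M}_i)\}_{i\in N},\{t_i\}_{i\in N})$ be a type space. Then exactly one of the following holds: (a) the players' beliefs in $T$ are universally consistent; (b) there exists a weakly agreeable bet in $T$.
   Context: A field on a set $X$ is a collection of subsets of $X$ containing $X$ and closed under complements and finite intersections. For a field $\mathcal{A}$ on $\Omega$, $\mathrm{pba}(\Omega,\mathcal{A})$ is the set of finitely additive nonnegative $P:\mathcal{A}\to\mathbb{R}$ with $P(\Omega)=1$; $B(\Omega,\mathcal{A})$ is the sup-norm closure of the linear span of indicators of sets in $\mathcal{A}$ (integrable against bounded finitely additive set functions). $\mathrm{ba}(\Omega,\mathcal{A})$ (bounded finitely additive set functions on $\mathcal{A}$) carries the weak* topology, the weakest making $\mu\mapsto\int f\,d\mu$ continuous for all $f\in B(\Omega,\mathcal{A})$; $\overline{\,\cdot\,}^\ast$ denotes weak* closure. A type space is $T=((\Omega,\mathcal{A}),\{(\Omega,\mathcal{M}_i)\}_{i\in N},\{t_i\}_{i\in N})$ with $N$ a nonempty set of players, $\mathcal{A}$ and $\mathcal{M}_i\subseteq\mathcal{A}$ fields on the set $\Omega$, and $t_i:\Omega\times\mathcal{A}\to[0,1]$ with: $t_i(\omega,\cdot)\in\mathrm{pba}(\Omega,\mathcal{A})$; $t_i(\cdot,E)\in B(\Omega,\mathcal{M}_i)$ for all $E\in\mathcal{A}$; $t_i(\omega,E)=1$ whenever $E\in\mathcal{M}_i$, $\omega\in E$. Let $\Pi_i=\overline{\mathrm{conv}\{t_i(\omega,\cdot):\omega\in\Omega\}}^\ast$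 (equivalently the $P\in\mathrm{pba}(\Omega,\mathcal{A})$ with $P(E\cap F)=\int_F t_i(\cdot,E)\,dP$ for all $E\in\mathcal{A},F\in\mathcal{M}_i$). For $I\subseteq N$, a nonempty $S\subseteq\Omega$ is an $I$-common certainty component if there is $E\in\mathcal{A}$ with $E\subseteq S$ and $t_i(\omega,E)=1$ for all $\omega\in S$, $i\in I$. A set $E\subseteq\Omega$ is $I$-commonly certain at $\omega$ if there is an $I$-common certainty component $S$ with $\omega\in S\subseteq E$. The players' beliefs are universally consistent if for every finite $I\subseteq N$ and every $I$-common certainty component $S$ there is $P\in\bigcap_{i\in I}\Pi_i$ with $\inf\{P(E):E\in\mathcal{A},\ S\subseteq E\}>0$. A bet is a family $(f_i)_{i\in I}$, $I\subseteq N$ finite, $f_i\in B(\Omega,\mathcal{A})$, with $\sum_{i\in I}f_i(\omega)=0$ for all $\omega$. A bet is weakly agreeable if for every $\omega\in\Omega$ the set $\{\omega':\int f_i\,dt_i(\omega',\cdot)\ge0\ \forall i\in I\}$ is $I$-commonly certain at $\omega$, and there exist $\omega\in\Omega$ and $\alpha>0$ such that $\{\omega':\int f_i\,dt_i(\omega',\cdot)\ge\alpha\ \forall i\in I\}$ is $I$-commonly certain at $\omega$.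
   Formalization: A bet is required to involve at least one player (I nonempty); with I empty allowed, the empty bet would be weakly agreeable in every type space with Ω nonempty, so (a) and (b) could both hold. *)

(* Defs.v *)
From Stdlib Require Import Reals List ClassicalEpsilon.
Open Scope R_scope.

Definition set (X : Type) := X -> Prop.

Definition is_field {X : Type} (F : set X -> Prop) : Prop :=
  F (fun _ => True) /\
  (forall E, F E -> F (fun x => ~ E x)) /\
  (forall E G, F E -> F G -> F (fun x => E x /\ G x)).

Definition ind {X : Type} (E : set X) (x : X) : R :=
  if excluded_middle_informative (E x) then 1 else 0.

Definition simple_in {X : Type} (F : set X -> Prop) (s : list (R * set X)) : Prop :=
  forall p, In p s -> F (snd p).
Definition simple_eval {X : Type} (s : list (R * set X)) (x : X) : R :=
  fold_right (fun p acc => fst p * ind (snd p) x + acc) 0 s.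
Definition simple_int {X : Type} (mu : set X -> R) (s : list (R * set X)) : R :=
  fold_right (fun p acc => fst p * mu (snd p) + acc) 0 s.

Definition in_B {X : Type} (F : set X -> Prop) (f : X -> R) : Prop :=
  forall eps, 0 < eps -> exists s, simple_in F s /\
    forall x, Rabs (f x - simple_eval s x) <= eps.

Definition fin_additive {X : Type} (F : set X -> Prop) (mu : set X -> R) : Prop :=
  forall E G, F E -> F G -> (forall x, E x -> G x -> False) ->
    mu (fun x => E x \/ G x) = mu E + mu G.

Definition is_ba {X : Type} (F : set X -> Prop) (mu : set X -> R) : Prop :=
  (exists M, forall E, F E -> Rabs (mu E) <= M) /\ fin_additive F mu.

Definition is_pba {X : Type} (F : set X -> Prop) (P : set X -> R) : Prop :=
  fin_additive F P /\ (forall E, F E -> 0 <= P E) /\ P (fun _ => True) = 1.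

Definition is_integral {X : Type} (F : set X -> Prop) (mu : set X -> R)
  (f : X -> R) (v : R) : Prop :=
  forall eps, 0 < eps -> exists s, simple_in F s /\
    (forall x, Rabs (f x - simple_eval s x) <= eps) /\
    Rabs (v - simple_int mu s) <= eps.

Definition integral {X : Type} (F : set X -> Prop) (mu : set X -> R) (f : X -> R) : R :=
  epsilon (inhabits 0) (is_integral F mu f).

Definition is_type_space {Om N : Type} (A : set Om -> Prop) (M : N -> set Om -> Prop)
  (t : N -> Om -> set Om -> R) : Prop :=
  is_field A /\
  (forall i, is_field (M i) /\ (forall E, M i E -> A E)) /\
  (forall i w, is_pba A (t i w)) /\
  (forall i E, A E -> in_B (M i) (fun w => t i w E)) /\
  (forall i E w, M i E -> E w -> t i w E = 1).

Definition conv_weights {Om : Type} (l : list (R * Om)) : Prop :=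
  (forall p, In p l -> 0 <= fst p) /\ fold_right (fun p acc => fst p + acc) 0 l = 1.
Definition conv_comb {Om : Type} (ti : Om -> set Om -> R) (l : list (R * Om)) : set Om -> R :=
  fun E => fold_right (fun p acc => fst p * ti (snd p) E + acc) 0 l.

(* Pi_i: weak* closure in ba(Om,A) of conv{t_i(w,.) : w in Om} *)
Definition Pi {Om N : Type} (A : set Om -> Prop) (t : N -> Om -> set Om -> R) (i : N)
  (P : set Om -> R) : Prop :=
  is_ba A P /\
  forall (fs : list (Om -> R)) eps, 0 < eps -> (forall f, In f fs -> in_B A f) ->
    exists l, conv_weights l /\
      forall f, In f fs -> Rabs (integral A P f - integral A (conv_comb (t i) l) f) < eps.

(* I-common certainty component (I a finite subset of N, given as a list) *)
Definition cc_component {Om N : Type} (A : set Om -> Prop) (t : N -> Om -> set Om -> R)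
  (I : list N) (S : set Om) : Prop :=
  (exists w, S w) /\
  exists E, A E /\ (forall w, E w -> S w) /\
    (forall w i, S w -> In i I -> t i w E = 1).

Definition commonly_certain {Om N : Type} (A : set Om -> Prop) (t : N -> Om -> set Om -> R)
  (I : list N) (E : set Om) (w : Om) : Prop :=
  exists S, cc_component A t I S /\ S w /\ (forall x, S x -> E x).

Definition universally_consistent {Om N : Type} (A : set Om -> Prop)
  (t : N -> Om -> set Om -> R) : Prop :=
  forall (I : list N) (S : set Om), cc_component A t I S ->
    exists P, is_pba A P /\ (forall i, In i I -> Pi A t i P) /\
      exists c, 0 < c /\ forall E, A E -> (forall w, S w -> E w) -> c <= P E.

Definition is_bet {Om N : Type} (A : set Om -> Prop) (I : list N) (f : N -> Om -> R) : Prop :=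
  I <> nil /\ NoDup I /\ (forall i, In i I -> in_B A (f i)) /\
  forall w, fold_right Rplus 0 (map (fun i => f i w) I) = 0.

Definition weakly_agreeable {Om N : Type} (A : set Om -> Prop) (t : N -> Om -> set Om -> R)
  (I : list N) (f : N -> Om -> R) : Prop :=
  is_bet A I f /\
  (forall w, commonly_certain A t I
     (fun w' => forall i, In i I -> 0 <= integral A (t i w') (f i)) w) /\
  (exists w alpha, 0 < alpha /\ commonly_certain A t I
     (fun w' => forall i, In i I -> alpha <= integral A (t i w') (f i)) w).

(* Main.v *)
(* Write T_i f (w) for the integral of f against t_i(w, .).

   Not both: if P lies in every Pi_i then f_i and T_i f_i have the same P-integral. For a
   weakly agreeable bet, T_i f_i is nonnegative and bounded away from 0 on a component of
   positive outer P-measure, so every f_i has a positive P-integral, although the f_i sum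
   to 0.

   One of the two: let S be a component witnessed by E, and let K be the convex cone of sums
   of functions h_i with T_i h_i >= 0 on E. If -1 is not in K, a maximal cone containing K
   but not -1 is a total preorder, hence gives a positive functional, i.e. a probability P
   with P(E) = 1; it lies in each Pi_i because a point of a finite-dimensional space that
   satisfies every half-space condition of a convex set is in its closure.
   If -1 is the sum of such h_i, then the functions f_i = (h_i + 1/n) 1_E form a bet with
   T_i f_i >= 1/n on E. As T_i f_i is measurable for M_i, a type w at which it is below 1/n
   is separated from E by a set of M_i, so t_i(w, E) = 0 and T_i f_i (w) = 0. Hence
   T_i f_i >= 0 everywhere, and T_i f_i >= 1/n on S. *)

From Stdlib Require Import Reals List ClassicalEpsilon Lra.
From Stdlib Require Import FunctionalExtensionality PropExtensionality.
From mathcomp Require classical_sets.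
Require Import Defs.
Open Scope R_scope.

(** * Finite sums *)

Definition lsum {K : Type} (l : list K) (g : K -> R) : R :=
  fold_right Rplus 0 (map g l).

Lemma lsum_ext_in {K : Type} (l : list K) (g h : K -> R) :
  (forall k, In k l -> g k = h k) -> lsum l g = lsum l h.
Proof.
  unfold lsum; induction l as [|k l IH]; intros H; simpl; auto.
  rewrite IH by (intros; apply H; right; assumption).
  rewrite (H k (or_introl eq_refl)); reflexivity.
Qed.

Lemma lsum_plus {K : Type} (l : list K) (g h : K -> R) :
  lsum l (fun k => g k + h k) = lsum l g + lsum l h.
Proof. unfold lsum; induction l; simpl; lra. Qed.

Lemma lsum_scal {K : Type} (l : list K) (c : R) (g : K -> R) :
  lsum l (fun k => c * g k) = c * lsum l g.
Proof.
  unfold lsum; induction l as [|k l IH]; simpl; [ring|rewrite IH; ring].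
Qed.

Lemma lsum_const {K : Type} (l : list K) (c : R) :
  lsum l (fun _ => c) = INR (length l) * c.
Proof.
  unfold lsum; induction l as [|k l IH]; [simpl; ring|].
  cbn [map fold_right length]; rewrite IH, S_INR; ring.
Qed.

Lemma lsum_le {K : Type} (l : list K) (g h : K -> R) :
  (forall k, In k l -> g k <= h k) -> lsum l g <= lsum l h.
Proof.
  unfold lsum; induction l as [|k l IH]; intros H; simpl; [lra|].
  apply Rplus_le_compat; [apply H; left; reflexivity|].
  apply IH; intros; apply H; right; assumption.
Qed.

Lemma lsum_nonneg {K : Type} (l : list K) (g : K -> R) :
  (forall k, In k l -> 0 <= g k) -> 0 <= lsum l g.
Proof.
  intros H; replace 0 with (lsum l (fun _ => 0)) by (rewrite lsum_const; ring).
  apply lsum_le, H.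
Qed.

Lemma lsum_app {K : Type} (l l' : list K) (g : K -> R) :
  lsum (l ++ l') g = lsum l g + lsum l' g.
Proof. unfold lsum; induction l; simpl; lra. Qed.

Lemma lsum_map {K L : Type} (l : list K) (u : K -> L) (g : L -> R) :
  lsum (map u l) g = lsum l (fun k => g (u k)).
Proof. unfold lsum; rewrite map_map; reflexivity. Qed.

Lemma lsum_swap {K L : Type} (l : list K) (l' : list L) (g : K -> L -> R) :
  lsum l (fun k => lsum l' (g k)) = lsum l' (fun k' => lsum l (fun k => g k k')).
Proof.
  induction l as [|k l IH].
  - change (0 = lsum l' (fun _ => 0)); rewrite lsum_const; ring.
  - change (lsum l' (g k) + lsum l (fun k => lsum l' (g k)) =
      lsum l' (fun k' => g k k' + lsum l (fun k => g k k'))).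
    rewrite IH, lsum_plus; reflexivity.
Qed.

Lemma lsum_ge_term {K : Type} (l : list K) (g : K -> R) (k : K) :
  (forall k, In k l -> 0 <= g k) -> In k l -> g k <= lsum l g.
Proof.
  induction l as [|k' l IH]; intros H Hk; [destruct Hk|].
  change (lsum (k' :: l) g) with (g k' + lsum l g).
  assert (H0 : 0 <= lsum l g)
    by (apply lsum_nonneg; intros; apply H; right; assumption).
  destruct Hk as [->|Hk]; [lra|].
  assert (g k <= lsum l g)
    by (apply IH; [intros; apply H; right; assumption|assumption]).
  pose proof (H k' (or_introl eq_refl)); lra.
Qed.

Lemma lsum_single {K : Type} (l : list K) (k : K) (c : R) : NoDup l -> In k l ->
  lsum l (fun k' => if excluded_middle_informative (k' = k) then c else 0) = c.
Proof.
  induction l as [|k' l IH]; intros Hd Hk; [destruct Hk|].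
  inversion Hd as [|? ? Hn Hd']; subst.
  change (lsum (k' :: l) (fun k' => if excluded_middle_informative (k' = k) then c else 0))
    with ((if excluded_middle_informative (k' = k) then c else 0) +
          lsum l (fun k' => if excluded_middle_informative (k' = k) then c else 0)).
  destruct (excluded_middle_informative (k' = k)) as [->|Hne].
  - rewrite (lsum_ext_in l _ (fun _ => 0)).
    + rewrite lsum_const; ring.
    + intros k' Hk'; destruct (excluded_middle_informative (k' = k)) as [->|]; tauto.
  - destruct Hk as [->|Hk]; [tauto|]; rewrite IH by assumption; ring.
Qed.

Lemma simple_eval_lsum {X : Type} (s : list (R * set X)) (x : X) :
  simple_eval s x = lsum s (fun p => fst p * ind (snd p) x).
Proof. unfold lsum; induction s; simpl; congruence. Qed.

Lemma simple_int_lsum {X : Type} (mu : set X -> R) (s : list (R * set X)) :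
  simple_int mu s = lsum s (fun p => fst p * mu (snd p)).
Proof. unfold lsum; induction s; simpl; congruence. Qed.

Lemma conv_comb_lsum {X : Type} (ti : X -> set X -> R) (l : list (R * X)) (E : set X) :
  conv_comb ti l E = lsum l (fun p => fst p * ti (snd p) E).
Proof. unfold conv_comb, lsum; induction l; simpl; congruence. Qed.

Lemma conv_weights_lsum {X : Type} (l : list (R * X)) :
  conv_weights l <-> (forall p, In p l -> 0 <= fst p) /\ lsum l fst = 1.
Proof.
  unfold conv_weights.
  replace (fold_right (fun p acc => fst p + acc) 0 l) with (lsum l fst); [tauto|].
  unfold lsum; induction l; simpl; congruence.
Qed.

(** * Fields of sets and finitely additive probabilities *)

Lemma set_ext {X : Type} (E G : set X) : (forall x, E x <-> G x) -> E = G.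
Proof.
  intros H; apply functional_extensionality; intros x.
  apply propositional_extensionality, H.
Qed.

Lemma ind_in {X : Type} (E : set X) (x : X) : E x -> ind E x = 1.
Proof. unfold ind; destruct (excluded_middle_informative (E x)); tauto. Qed.

Lemma ind_out {X : Type} (E : set X) (x : X) : ~ E x -> ind E x = 0.
Proof. unfold ind; destruct (excluded_middle_informative (E x)); tauto. Qed.

Lemma ind_range {X : Type} (E : set X) (x : X) : 0 <= ind E x <= 1.
Proof. unfold ind; destruct (excluded_middle_informative (E x)); lra. Qed.

Lemma ind_compl {X : Type} (E : set X) (x : X) : ind (fun y => ~ E y) x = 1 - ind E x.
Proof.
  destruct (classic (E x)) as [H|H].
  - rewrite (ind_in E), ind_out by tauto; ring.
  - rewrite (ind_out E), ind_in by tauto; ring.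
Qed.

Lemma ind_disjoint_union {X : Type} (E G : set X) (x : X) : (E x -> G x -> False) ->
  ind (fun y => E y \/ G y) x = ind E x + ind G x.
Proof.
  intros HEG; unfold ind.
  destruct (excluded_middle_informative (E x)); destruct (excluded_middle_informative (G x));
    destruct (excluded_middle_informative (E x \/ G x)); (tauto || lra).
Qed.

Lemma field_union {X : Type} (A : set X -> Prop) (E G : set X) : is_field A ->
  A E -> A G -> A (fun x => E x \/ G x).
Proof.
  intros [_ [HC HI]] HE HG.
  replace (fun x => E x \/ G x) with (fun x => ~ (~ E x /\ ~ G x)).
  - apply HC, HI; apply HC; assumption.
  - apply set_ext; intros x; destruct (classic (E x)); tauto.
Qed.

Lemma field_empty {X : Type} (A : set X -> Prop) : is_field A -> A (fun _ => False).
Proof.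
  intros [HT [HC _]]; replace (fun _ : X => False) with (fun _ : X => ~ True).
  - apply HC, HT.
  - apply set_ext; tauto.
Qed.

Lemma pba_empty {X : Type} (A : set X -> Prop) (mu : set X -> R) :
  is_field A -> is_pba A mu -> mu (fun _ => False) = 0.
Proof.
  intros HA [Hadd _].
  pose proof (Hadd _ _ (field_empty A HA) (field_empty A HA) (fun x H _ => H)) as H.
  cbv beta in H; rewrite (set_ext (fun _ : X => False \/ False) (fun _ => False)) in H by tauto.
  lra.
Qed.

Lemma pba_split {X : Type} (A : set X -> Prop) (mu : set X -> R) (E G : set X) :
  is_field A -> is_pba A mu -> A E -> A G ->
  mu G = mu (fun x => G x /\ E x) + mu (fun x => G x /\ ~ E x).
Proof.
  intros HA [Hadd _] HE HG; destruct HA as [_ [HC HI]].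
  rewrite <- Hadd; auto; [|intros; tauto].
  f_equal; apply set_ext; intros x; destruct (classic (E x)); tauto.
Qed.

Lemma pba_compl {X : Type} (A : set X -> Prop) (mu : set X -> R) (E : set X) :
  is_field A -> is_pba A mu -> A E -> mu (fun x => ~ E x) = 1 - mu E.
Proof.
  intros HA Hmu HE.
  pose proof (pba_split A mu E (fun _ => True) HA Hmu HE (proj1 HA)) as H.
  destruct Hmu as [_ [_ H1]]; rewrite H1 in H.
  replace (fun x => True /\ E x) with E in H by (apply set_ext; tauto).
  replace (fun x => True /\ ~ E x) with (fun x => ~ E x) in H by (apply set_ext; tauto).
  lra.
Qed.

Lemma pba_mono {X : Type} (A : set X -> Prop) (mu : set X -> R) (E G : set X) :
  is_field A -> is_pba A mu -> A E -> A G -> (forall x, E x -> G x) -> mu E <= mu G.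
Proof.
  intros HA Hmu HE HG H.
  rewrite (pba_split A mu E G) by assumption.
  replace (fun x => G x /\ E x) with E
    by (apply set_ext; intros x; specialize (H x); tauto).
  destruct Hmu as [_ [H0 _]]; destruct HA as [_ [HC HI]].
  specialize (H0 (fun x => G x /\ ~ E x)); specialize (H0 (HI _ _ HG (HC _ HE))); lra.
Qed.

Lemma pba_le1 {X : Type} (A : set X -> Prop) (mu : set X -> R) (E : set X) :
  is_field A -> is_pba A mu -> A E -> mu E <= 1.
Proof.
  intros HA Hmu HE; destruct Hmu as [Ha [H0 H1]]; rewrite <- H1.
  apply (pba_mono A); try assumption; [split; auto|apply HA|tauto].
Qed.

(** * Simple functions *)

Lemma simple_in_cons {X : Type} (A : set X -> Prop) (p : R * set X) s :
  simple_in A (p :: s) <-> A (snd p) /\ simple_in A s.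
Proof.
  unfold simple_in; split.
  - intros H; split; [apply H; left; reflexivity|intros q Hq; apply H; right; exact Hq].
  - intros [H1 H2] q [<-|Hq]; auto.
Qed.

Lemma simple_in_app {X : Type} (A : set X -> Prop) (s s' : list (R * set X)) :
  simple_in A s -> simple_in A s' -> simple_in A (s ++ s').
Proof. intros H H' p Hp; apply in_app_or in Hp; destruct Hp; auto. Qed.

Definition simple_scal {X : Type} (a : R) (s : list (R * set X)) : list (R * set X) :=
  map (fun p => (a * fst p, snd p)) s.

Definition simple_const {X : Type} (a : R) : list (R * set X) := (a, fun _ => True) :: nil.

Lemma simple_scal_in {X : Type} (A : set X -> Prop) a (s : list (R * set X)) :
  simple_in A s -> simple_in A (simple_scal a s).
Proof. intros H p Hp; apply in_map_iff in Hp; destruct Hp as [q [<- Hq]]; exact (H q Hq). Qed.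

Lemma simple_const_in {X : Type} (A : set X -> Prop) a :
  is_field A -> simple_in A (simple_const a).
Proof. intros [H _] p [<-|[]]; exact H. Qed.

Lemma simple_eval_cons {X : Type} a E (s : list (R * set X)) x :
  simple_eval ((a, E) :: s) x = a * ind E x + simple_eval s x.
Proof. reflexivity. Qed.

Lemma simple_eval_app {X : Type} (s s' : list (R * set X)) x :
  simple_eval (s ++ s') x = simple_eval s x + simple_eval s' x.
Proof. rewrite !simple_eval_lsum; apply lsum_app. Qed.

Lemma simple_int_app {X : Type} mu (s s' : list (R * set X)) :
  simple_int mu (s ++ s') = simple_int mu s + simple_int mu s'.
Proof. rewrite !simple_int_lsum; apply lsum_app. Qed.

Lemma simple_eval_scal {X : Type} a (s : list (R * set X)) x :
  simple_eval (simple_scal a s) x = a * simple_eval s x.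
Proof.
  rewrite !simple_eval_lsum; unfold simple_scal; rewrite lsum_map, <- lsum_scal.
  apply lsum_ext_in; intros; simpl; ring.
Qed.

Lemma simple_int_scal {X : Type} mu a (s : list (R * set X)) :
  simple_int mu (simple_scal a s) = a * simple_int mu s.
Proof.
  rewrite !simple_int_lsum; unfold simple_scal; rewrite lsum_map, <- lsum_scal.
  apply lsum_ext_in; intros; simpl; ring.
Qed.

Lemma simple_eval_const {X : Type} a (x : X) : simple_eval (simple_const a) x = a.
Proof. simpl; rewrite ind_in by exact I; ring. Qed.

Lemma simple_int_const {X : Type} (A : set X -> Prop) mu a :
  is_pba A mu -> simple_int mu (simple_const a) = a.
Proof. intros [_ [_ H]]; simpl; rewrite H; ring. Qed.

(* Refining the cell [G] by one set of [s] at a time avoids putting [s] in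
   disjoint normal form. *)
Lemma simple_int_nonneg_on {X : Type} (A : set X -> Prop) mu (s : list (R * set X)) :
  is_field A -> is_pba A mu -> simple_in A s -> forall G c, A G ->
  (forall x, G x -> 0 <= c + simple_eval s x) ->
  0 <= c * mu G + lsum s (fun p => fst p * mu (fun x => G x /\ snd p x)).
Proof.
  intros HA Hmu; induction s as [|[a E] s IH]; intros Hs G c HG H.
  (* A point of [G] shows [0 <= c]; an empty cell has measure 0, whatever the sign of [c]. *)
  - unfold lsum; simpl in *; destruct (classic (exists x, G x)) as [[x Hx]|Hn].
    + pose proof (proj1 (proj2 Hmu) G HG); specialize (H x Hx); nra.
    + replace G with (fun _ : X => False) by (apply set_ext; firstorder).
      rewrite (pba_empty A mu HA Hmu); lra.
  - apply simple_in_cons in Hs; destruct Hs as [HE Hs]; simpl in HE.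
    destruct HA as [HAt [HC HI]].
    assert (HA : is_field A) by (split; auto).
    (* The constant collects the coefficients of those sets already treated that contain the current
       cell: [a] is added on the part inside [E] and nothing on the part outside. *)
    assert (H1 := IH Hs (fun x => G x /\ E x) (c + a) (HI _ _ HG HE)).
    assert (H2 := IH Hs (fun x => G x /\ ~ E x) c (HI _ _ HG (HC _ HE))).
    assert (H1' : forall x, G x /\ E x -> 0 <= c + a + simple_eval s x).
    { intros x [Hx HEx]; specialize (H x Hx); rewrite simple_eval_cons, ind_in in H by assumption; lra. }
    assert (H2' : forall x, G x /\ ~ E x -> 0 <= c + simple_eval s x).
    { intros x [Hx HEx]; specialize (H x Hx); rewrite simple_eval_cons, ind_out in H by assumption; lra. }
    specialize (H1 H1'); specialize (H2 H2').
    change (lsum ((a, E) :: s) (fun p => fst p * mu (fun x => G x /\ snd p x)))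
      with (a * mu (fun x => G x /\ E x) + lsum s (fun p => fst p * mu (fun x => G x /\ snd p x))).
    rewrite (pba_split A mu E G HA Hmu HE HG).
    rewrite (lsum_ext_in s (fun p => fst p * mu (fun x => G x /\ snd p x))
      (fun p => fst p * mu (fun x => (G x /\ E x) /\ snd p x) +
                fst p * mu (fun x => (G x /\ ~ E x) /\ snd p x))).
    + rewrite lsum_plus; nra.
    + intros p Hp.
      rewrite (pba_split A mu E (fun x => G x /\ snd p x) HA Hmu HE (HI _ _ HG (Hs p Hp))).
      rewrite Rmult_plus_distr_l.
      f_equal; f_equal; f_equal; apply set_ext; tauto.
Qed.

Lemma simple_int_nonneg {X : Type} (A : set X -> Prop) mu (s : list (R * set X)) :
  is_field A -> is_pba A mu -> simple_in A s ->
  (forall x, 0 <= simple_eval s x) -> 0 <= simple_int mu s.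
Proof.
  intros HA Hmu Hs H.
  pose proof (simple_int_nonneg_on A mu s HA Hmu Hs (fun _ => True) 0 (proj1 HA)) as H0.
  rewrite simple_int_lsum.
  rewrite (lsum_ext_in s (fun p => fst p * mu (snd p))
    (fun p => fst p * mu (fun x => True /\ snd p x))).
  - assert (forall x : X, True -> 0 <= 0 + simple_eval s x)
      by (intros x _; specialize (H x); lra); specialize (H0 H1); lra.
  - intros p _; f_equal; f_equal; apply set_ext; tauto.
Qed.

(** Nonnegativity is applied to [s' + c - s]. The slack [c] makes uniformly close simple functions
    have close integrals. *)
Lemma simple_int_le {X : Type} (A : set X -> Prop) mu (s s' : list (R * set X)) c :
  is_field A -> is_pba A mu -> simple_in A s -> simple_in A s' ->
  (forall x, simple_eval s x <= simple_eval s' x + c) ->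
  simple_int mu s <= simple_int mu s' + c.
Proof.
  intros HA Hmu Hs Hs' H.
  assert (H0 : 0 <= simple_int mu (s' ++ simple_const c ++ simple_scal (-1) s)).
  { apply (simple_int_nonneg A); auto.
    - repeat apply simple_in_app; auto using simple_const_in, simple_scal_in.
    - intros x; rewrite !simple_eval_app, simple_eval_const, simple_eval_scal.
      specialize (H x); lra. }
  rewrite !simple_int_app, (simple_int_const A), simple_int_scal in H0 by assumption; lra.
Qed.

(** The threshold varies in the induction: removing [(a, E)] shifts it to [c - a] inside [E] and
    leaves it at [c] outside. *)
Lemma simple_level_set {X : Type} (A : set X -> Prop) (s : list (R * set X)) :
  is_field A -> simple_in A s -> forall c, A (fun x => c <= simple_eval s x).
Proof.
  intros HA; destruct (HA) as [HT [HC HI]].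
  induction s as [|[a E] s IH]; intros Hs c.
  - destruct (Rle_dec c 0).
    + replace (fun _ : X => c <= simple_eval nil _) with (fun _ : X => True); auto.
      apply set_ext; simpl; tauto.
    + replace (fun x : X => c <= simple_eval nil x) with (fun _ : X => False);
        [apply field_empty, HA|apply set_ext; simpl; tauto].
  - apply simple_in_cons in Hs; destruct Hs as [HE Hs]; simpl in HE.
    replace (fun x => c <= simple_eval ((a, E) :: s) x) with
      (fun x => (E x /\ c - a <= simple_eval s x) \/ (~ E x /\ c <= simple_eval s x)).
    + apply field_union; auto.
    + apply set_ext; intros x; rewrite simple_eval_cons; destruct (classic (E x)) as [Hx|Hx].
      * rewrite ind_in by assumption; split; [intros [?|?]; [lra|tauto]|left; split; [assumption|lra]].
      * rewrite ind_out by assumption; split; [intros [?|?]; [tauto|lra]|right; split; [assumption|lra]].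
Qed.

(** * The space [B] *)

Lemma in_B_of_approx {X : Type} (A : set X -> Prop) (f : X -> R) :
  (forall eps, 0 < eps -> exists g, in_B A g /\ forall x, Rabs (f x - g x) <= eps) ->
  in_B A f.
Proof.
  intros H eps He; destruct (H (eps / 2)) as [g [Hg Hfg]]; [lra|].
  destruct (Hg (eps / 2)) as [s [Hs Hgs]]; [lra|].
  exists s; split; auto; intros x.
  replace (f x - simple_eval s x) with ((f x - g x) + (g x - simple_eval s x)) by ring.
  pose proof (Rabs_triang (f x - g x) (g x - simple_eval s x)).
  specialize (Hfg x); specialize (Hgs x); lra.
Qed.

Lemma in_B_simple {X : Type} (A : set X -> Prop) (s : list (R * set X)) :
  simple_in A s -> in_B A (simple_eval s).
Proof.
  intros Hs eps He; exists s; split; auto; intros x.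
  rewrite Rminus_diag, Rabs_R0; lra.
Qed.

Lemma in_B_const {X : Type} (A : set X -> Prop) c : is_field A -> in_B A (fun _ : X => c).
Proof.
  intros HA; replace (fun _ : X => c) with (simple_eval (@simple_const X c)).
  - apply in_B_simple, simple_const_in, HA.
  - apply functional_extensionality; intros x; apply simple_eval_const.
Qed.

Lemma in_B_ind {X : Type} (A : set X -> Prop) E : A E -> in_B A (ind E).
Proof.
  intros HE; replace (ind E) with (simple_eval ((1, E) :: nil)).
  - apply in_B_simple; intros p [<-|[]]; exact HE.
  - apply functional_extensionality; intros x; simpl; ring.
Qed.

Lemma in_B_plus {X : Type} (A : set X -> Prop) f g :
  in_B A f -> in_B A g -> in_B A (fun x => f x + g x).
Proof.
  intros Hf Hg eps He.
  destruct (Hf (eps / 2)) as [s [Hs Hfs]]; [lra|].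
  destruct (Hg (eps / 2)) as [s' [Hs' Hgs]]; [lra|].
  exists (s ++ s'); split; [apply simple_in_app; auto|]; intros x.
  rewrite simple_eval_app.
  replace (f x + g x - (simple_eval s x + simple_eval s' x))
    with ((f x - simple_eval s x) + (g x - simple_eval s' x)) by ring.
  pose proof (Rabs_triang (f x - simple_eval s x) (g x - simple_eval s' x)).
  specialize (Hfs x); specialize (Hgs x); lra.
Qed.

Lemma in_B_scal {X : Type} (A : set X -> Prop) a f :
  in_B A f -> in_B A (fun x => a * f x).
Proof.
  intros Hf eps He.
  (* Adding 1 keeps the divisor positive when [a = 0]. *)
  assert (Ha : 0 < Rabs a + 1) by (pose proof (Rabs_pos a); lra).
  destruct (Hf (eps / (Rabs a + 1))) as [s [Hs Hfs]]; [apply Rdiv_lt_0_compat; lra|].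
  exists (simple_scal a s); split; [apply simple_scal_in; auto|]; intros x.
  rewrite simple_eval_scal, <- Rmult_minus_distr_l, Rabs_mult.
  specialize (Hfs x).
  apply Rle_trans with ((Rabs a + 1) * (eps / (Rabs a + 1))); [|right; field; lra].
  apply Rmult_le_compat; try apply Rabs_pos; lra.
Qed.

Lemma in_B_lsum {X K : Type} (A : set X -> Prop) (l : list K) (F : K -> X -> R) :
  is_field A -> (forall k, In k l -> in_B A (F k)) -> in_B A (fun x => lsum l (fun k => F k x)).
Proof.
  intros HA; induction l as [|k l IH]; intros H.
  - apply (in_B_const A 0 HA).
  - apply (in_B_plus A (F k) (fun x => lsum l (fun k => F k x))).
    + apply H; left; reflexivity.
    + apply IH; intros; apply H; right; assumption.
Qed.

Lemma in_B_mul_ind {X : Type} (A : set X -> Prop) f E : is_field A ->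
  in_B A f -> A E -> in_B A (fun x => f x * ind E x).
Proof.
  intros [_ [_ HI]] Hf HE eps He.
  destruct (Hf eps He) as [s [Hs Hfs]].
  exists (map (fun p => (fst p, fun x => snd p x /\ E x)) s); split.
  - intros p Hp; apply in_map_iff in Hp; destruct Hp as [q [<- Hq]].
    apply HI; auto.
  - intros x.
    replace (simple_eval (map (fun p => (fst p, fun x => snd p x /\ E x)) s) x)
      with (simple_eval s x * ind E x).
    + rewrite <- Rmult_minus_distr_r, Rabs_mult.
      destruct (ind_range E x); rewrite (Rabs_pos_eq (ind E x)) by assumption.
      specialize (Hfs x); pose proof (Rabs_pos (f x - simple_eval s x)); nra.
    + rewrite !simple_eval_lsum, lsum_map, Rmult_comm, <- lsum_scal.
      apply lsum_ext_in; intros [a G] _; simpl.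
      destruct (classic (E x)) as [H|H].
      * rewrite (ind_in E) by assumption.
        destruct (classic (G x)) as [H'|H'].
        -- rewrite (ind_in (G)), (ind_in (fun x => G x /\ E x)) by tauto; ring.
        -- rewrite (ind_out (G)), (ind_out (fun x => G x /\ E x)) by tauto; ring.
      * rewrite (ind_out E), (ind_out (fun x => G x /\ E x)) by tauto; ring.
Qed.

Lemma in_B_sub {X : Type} (A M : set X -> Prop) f :
  (forall E, M E -> A E) -> in_B M f -> in_B A f.
Proof.
  intros H Hf eps He; destruct (Hf eps He) as [s [Hs Hfs]].
  exists s; split; auto; intros p Hp; auto.
Qed.

Lemma in_B_bounded {X : Type} (A : set X -> Prop) f :
  in_B A f -> exists C, 0 <= C /\ forall x, Rabs (f x) <= C.
Proof.
  intros Hf; destruct (Hf 1 Rlt_0_1) as [s [_ Hs]].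
  (* The 1 is the approximation error; since indicators lie between 0 and 1, the absolute
     coefficients bound the simple function. *)
  exists (1 + lsum s (fun p => Rabs (fst p))).
  assert (H0 : 0 <= lsum s (fun p => Rabs (fst p)))
    by (apply lsum_nonneg; intros; apply Rabs_pos).
  split; [lra|]; intros x.
  assert (H1 : Rabs (simple_eval s x) <= lsum s (fun p => Rabs (fst p))).
  { clear. rewrite simple_eval_lsum; unfold lsum.
    induction s as [|[a E] s IH]; simpl; [rewrite Rabs_R0; lra|].
    eapply Rle_trans; [apply Rabs_triang|].
    apply Rplus_le_compat; [|exact IH].
    destruct (ind_range E x); rewrite Rabs_mult, (Rabs_pos_eq (ind E x)) by assumption.
    pose proof (Rabs_pos a); nra. }
  specialize (Hs x).
  replace (f x) with ((f x - simple_eval s x) + simple_eval s x) by ring.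
  eapply Rle_trans; [apply Rabs_triang|]; lra.
Qed.

(** A level set of [g] itself may lie outside the field, so that of a simple approximation replaces
    it. The cut is at the midpoint of [a] and [b], and the error [(b - a) / 3] is less than half the
    gap. *)
Lemma in_B_level_separation {X : Type} (A : set X -> Prop) g a b :
  is_field A -> in_B A g -> a < b ->
  exists F, A F /\ (forall x, b <= g x -> F x) /\ (forall x, F x -> a < g x).
Proof.
  intros HA Hg Hab; destruct (Hg ((b - a) / 3)) as [s [Hs H]]; [lra|].
  exists (fun x => (a + b) / 2 <= simple_eval s x); split.
  - apply simple_level_set; auto.
  - split; intros x Hx; specialize (H x);
      destruct (Rcase_abs (g x - simple_eval s x)) as [Hc|Hc];
      (rewrite Rabs_left in H by assumption) || (rewrite Rabs_right in H by assumption); lra.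
Qed.

(** * The integral *)

(* The value is [sup { int s | s simple, s <= f }]. *)
Lemma integral_approx_exists {X : Type} (A : set X -> Prop) mu f :
  is_field A -> is_pba A mu -> in_B A f ->
  exists v, forall s e, simple_in A s -> (forall x, Rabs (f x - simple_eval s x) <= e) ->
    Rabs (v - simple_int mu s) <= e.
Proof.
  intros HA Hmu Hf.
  set (L := fun r => exists s, simple_in A s /\ (forall x, simple_eval s x <= f x) /\
                     r = simple_int mu s).
  assert (Hup : forall s e, simple_in A s -> (forall x, Rabs (f x - simple_eval s x) <= e) ->
            is_upper_bound L (simple_int mu s + e)).
  { intros s e Hs H r [s' [Hs' [H' ->]]].
    apply (simple_int_le A); auto; intros x.
    specialize (H' x); specialize (H x).
    pose proof (Rle_abs (f x - simple_eval s x)); lra. }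
  assert (Hlow : forall s e, simple_in A s -> (forall x, Rabs (f x - simple_eval s x) <= e) ->
            L (simple_int mu s - e)).
  { intros s e Hs H; exists (s ++ simple_const (- e)); split; [|split].
    - apply simple_in_app; auto using simple_const_in.
    - intros x; rewrite simple_eval_app, simple_eval_const; specialize (H x).
      pose proof (Rle_abs (- (f x - simple_eval s x))) as H1; rewrite Rabs_Ropp in H1; lra.
    - rewrite simple_int_app, (simple_int_const A) by assumption; ring. }
  destruct (Hf 1 Rlt_0_1) as [s0 [Hs0 H0]].
  destruct (completeness L) as [v [Hv1 Hv2]].
  - exists (simple_int mu s0 + 1); auto.
  - exists (simple_int mu s0 - 1); auto.
  - exists v; intros s e Hs H.
    apply Rabs_le; split.
    + specialize (Hv1 _ (Hlow s e Hs H)); lra.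
    + specialize (Hv2 _ (Hup s e Hs H)); lra.
Qed.

(** [integral] chooses some number satisfying [is_integral]. Compared with the value [v] of
    [integral_approx_exists] along common approximations, it equals [v] and so inherits the bound
    for every approximation. *)
Lemma integral_approx {X : Type} (A : set X -> Prop) mu f s e :
  is_field A -> is_pba A mu -> in_B A f -> simple_in A s ->
  (forall x, Rabs (f x - simple_eval s x) <= e) ->
  Rabs (integral A mu f - simple_int mu s) <= e.
Proof.
  intros HA Hmu Hf Hs H.
  destruct (integral_approx_exists A mu f HA Hmu Hf) as [v Hv].
  assert (Hi : is_integral A mu f (integral A mu f)).
  { unfold integral; apply epsilon_spec; exists v; intros eps He.
    destruct (Hf eps He) as [s' [Hs' H']]; exists s'; auto. }
  replace (integral A mu f) with v; auto.
  apply cond_eq; intros eps He.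
  destruct (Hi (eps / 3)) as [s' [Hs' [H1 H2]]]; [lra|].
  specialize (Hv s' (eps / 3) Hs' H1).
  replace (v - integral A mu f) with
    ((v - simple_int mu s') - (integral A mu f - simple_int mu s')) by ring.
  pose proof (Rabs_triang (v - simple_int mu s') (- (integral A mu f - simple_int mu s'))) as H3.
  rewrite Rabs_Ropp in H3; unfold Rminus in *; lra.
Qed.

(** This is how integrals are computed below: one suitable simple function for each error is
    enough. *)
Lemma integral_unique {X : Type} (A : set X -> Prop) mu f v :
  is_field A -> is_pba A mu -> is_integral A mu f v -> integral A mu f = v.
Proof.
  intros HA Hmu Hi; apply cond_eq; intros eps He.
  assert (Hf : in_B A f)
    by (intros e He'; destruct (Hi e He') as [s [Hs [H _]]]; exists s; auto).
  destruct (Hi (eps / 3)) as [s [Hs [H1 H2]]]; [lra|].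
  pose proof (integral_approx A mu f s (eps / 3) HA Hmu Hf Hs H1) as H3.
  replace (integral A mu f - v) with
    ((integral A mu f - simple_int mu s) + - (v - simple_int mu s)) by ring.
  eapply Rle_lt_trans; [apply Rabs_triang|]; rewrite Rabs_Ropp; lra.
Qed.

Lemma integral_simple {X : Type} (A : set X -> Prop) mu s :
  is_field A -> is_pba A mu -> simple_in A s ->
  integral A mu (simple_eval s) = simple_int mu s.
Proof.
  intros HA Hmu Hs; apply integral_unique; auto.
  intros eps He; exists s; split; auto; split; intros; rewrite Rminus_diag, Rabs_R0; lra.
Qed.

Lemma integral_const {X : Type} (A : set X -> Prop) mu c :
  is_field A -> is_pba A mu -> integral A mu (fun _ => c) = c.
Proof.
  intros HA Hmu; transitivity (integral A mu (simple_eval (simple_const c))).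
  - f_equal; apply functional_extensionality; intros x; symmetry; apply simple_eval_const.
  - rewrite integral_simple by auto using simple_const_in.
    apply (simple_int_const A), Hmu.
Qed.

Lemma integral_ind {X : Type} (A : set X -> Prop) mu E :
  is_field A -> is_pba A mu -> A E -> integral A mu (ind E) = mu E.
Proof.
  intros HA Hmu HE; replace (ind E) with (simple_eval ((1, E) :: nil)).
  - rewrite integral_simple; auto; [simpl; ring|].
    intros p [<-|[]]; exact HE.
  - apply functional_extensionality; intros x; simpl; ring.
Qed.

Lemma integral_plus {X : Type} (A : set X -> Prop) mu f g :
  is_field A -> is_pba A mu -> in_B A f -> in_B A g ->
  integral A mu (fun x => f x + g x) = integral A mu f + integral A mu g.
Proof.
  intros HA Hmu Hf Hg; apply integral_unique; auto; intros eps He.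
  destruct (Hf (eps / 2)) as [s [Hs H]]; [lra|].
  destruct (Hg (eps / 2)) as [s' [Hs' H']]; [lra|].
  pose proof (integral_approx A mu f s _ HA Hmu Hf Hs H) as H1.
  pose proof (integral_approx A mu g s' _ HA Hmu Hg Hs' H') as H2.
  exists (s ++ s'); split; [apply simple_in_app; auto|]; split.
  - intros x; rewrite simple_eval_app.
    replace (f x + g x - (simple_eval s x + simple_eval s' x))
      with ((f x - simple_eval s x) + (g x - simple_eval s' x)) by ring.
    specialize (H x); specialize (H' x).
    eapply Rle_trans; [apply Rabs_triang|]; lra.
  - rewrite simple_int_app.
    replace (integral A mu f + integral A mu g - (simple_int mu s + simple_int mu s'))
      with ((integral A mu f - simple_int mu s) + (integral A mu g - simple_int mu s')) by ring.
    eapply Rle_trans; [apply Rabs_triang|]; lra.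
Qed.

Lemma integral_scal {X : Type} (A : set X -> Prop) mu a f :
  is_field A -> is_pba A mu -> in_B A f ->
  integral A mu (fun x => a * f x) = a * integral A mu f.
Proof.
  intros HA Hmu Hf; apply integral_unique; auto; intros eps He.
  assert (Ha : 0 < Rabs a + 1) by (pose proof (Rabs_pos a); lra).
  assert (He' : 0 < eps / (Rabs a + 1)) by (apply Rdiv_lt_0_compat; lra).
  assert (Hb : forall r, Rabs r <= eps / (Rabs a + 1) -> Rabs (a * r) <= eps).
  { intros r Hr; rewrite Rabs_mult.
    apply Rle_trans with ((Rabs a + 1) * (eps / (Rabs a + 1))); [|right; field; lra].
    apply Rmult_le_compat; try apply Rabs_pos; lra. }
  destruct (Hf _ He') as [s [Hs H]].
  exists (simple_scal a s); split; [apply simple_scal_in; auto|]; split.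
  - intros x; rewrite simple_eval_scal, <- Rmult_minus_distr_l; auto.
  - rewrite simple_int_scal, <- Rmult_minus_distr_l.
    apply Hb, integral_approx; auto.
Qed.

Lemma integral_lsum {X K : Type} (A : set X -> Prop) mu (l : list K) (F : K -> X -> R) :
  is_field A -> is_pba A mu -> (forall k, In k l -> in_B A (F k)) ->
  integral A mu (fun x => lsum l (fun k => F k x)) = lsum l (fun k => integral A mu (F k)).
Proof.
  intros HA Hmu; induction l as [|k l IH]; intros H.
  - apply (integral_const A mu 0 HA Hmu).
  - change (integral A mu (fun x => F k x + lsum l (fun k => F k x)) =
      integral A mu (F k) + lsum l (fun k => integral A mu (F k))).
    rewrite integral_plus; auto.
    + rewrite IH by (intros; apply H; right; assumption); reflexivity.
    + apply H; left; reflexivity.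
    + apply in_B_lsum; auto; intros; apply H; right; assumption.
Qed.

Lemma integral_nonneg {X : Type} (A : set X -> Prop) mu f :
  is_field A -> is_pba A mu -> in_B A f -> (forall x, 0 <= f x) -> 0 <= integral A mu f.
Proof.
  intros HA Hmu Hf H; apply Rnot_lt_le; intros Hn.
  destruct (Hf (- integral A mu f / 3)) as [s [Hs Hfs]]; [lra|].
  pose proof (integral_approx A mu f s _ HA Hmu Hf Hs Hfs) as H1.
  assert (H2 : simple_int mu nil <= simple_int mu s + - integral A mu f / 3).
  { apply (simple_int_le A); auto; [intros p []|].
    intros x; specialize (H x); specialize (Hfs x); simpl.
    pose proof (Rle_abs (f x - simple_eval s x)); lra. }
  simpl in H2.
  pose proof (Rle_abs (- (integral A mu f - simple_int mu s))) as H3; rewrite Rabs_Ropp in H3; lra.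
Qed.

Lemma integral_le {X : Type} (A : set X -> Prop) mu f g :
  is_field A -> is_pba A mu -> in_B A f -> in_B A g -> (forall x, f x <= g x) ->
  integral A mu f <= integral A mu g.
Proof.
  intros HA Hmu Hf Hg H.
  assert (H0 : 0 <= integral A mu (fun x => g x + (-1) * f x)).
  { apply integral_nonneg; auto.
    - apply in_B_plus; auto; apply in_B_scal; auto.
    - intros x; specialize (H x); lra. }
  rewrite integral_plus, integral_scal in H0; auto; [lra|apply in_B_scal; auto].
Qed.

Lemma integral_abs_le {X : Type} (A : set X -> Prop) mu f c :
  is_field A -> is_pba A mu -> in_B A f -> (forall x, Rabs (f x) <= c) ->
  Rabs (integral A mu f) <= c.
Proof.
  intros HA Hmu Hf H; apply Rabs_le; split.
  - rewrite <- (integral_const A mu (- c)) by assumption.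
    apply integral_le; auto using in_B_const; intros x.
    specialize (H x); pose proof (Rle_abs (- f x)) as H1; rewrite Rabs_Ropp in H1; lra.
  - rewrite <- (integral_const A mu c) by assumption.
    apply integral_le; auto using in_B_const; intros x.
    specialize (H x); pose proof (Rle_abs (f x)); lra.
Qed.

(** A bound [C] of [f] places it between [- C * ind G] and [C * ind G], both of integral 0. *)
Lemma integral_null {X : Type} (A : set X -> Prop) mu f G :
  is_field A -> is_pba A mu -> in_B A f -> A G -> mu G = 0 ->
  (forall x, ~ G x -> f x = 0) -> integral A mu f = 0.
Proof.
  intros HA Hmu Hf HG H0 H.
  destruct (in_B_bounded A f Hf) as [C [HC Hb]].
  assert (Hi : forall a, integral A mu (fun x => a * ind G x) = 0)
    by (intros a; rewrite integral_scal, integral_ind, H0; auto using in_B_ind; ring).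
  assert (HB : forall a, in_B A (fun x => a * ind G x)) by (auto using in_B_scal, in_B_ind).
  assert (Hx : forall x, - C * ind G x <= f x <= C * ind G x).
  { intros x; destruct (classic (G x)) as [HGx|HGx].
    - rewrite ind_in by assumption; specialize (Hb x).
      pose proof (Rle_abs (f x)) as H2; pose proof (Rle_abs (- f x)) as H1.
      rewrite Rabs_Ropp in H1; lra.
    - rewrite ind_out, H by assumption; lra. }
  apply Rle_antisym.
  - rewrite <- (Hi C); apply integral_le; auto; apply Hx.
  - rewrite <- (Hi (- C)); apply integral_le; auto; apply Hx.
Qed.

Lemma integral_mul_ind_full {X : Type} (A : set X -> Prop) mu f E :
  is_field A -> is_pba A mu -> in_B A f -> A E -> mu E = 1 ->
  integral A mu (fun x => f x * ind E x) = integral A mu f.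
Proof.
  intros HA Hmu Hf HE H1.
  assert (HE' : A (fun x => ~ E x)) by (apply HA; assumption).
  assert (Hc : in_B A (fun x => f x * ind (fun y => ~ E y) x))
    by (apply in_B_mul_ind; auto).
  assert (H0 : integral A mu (fun x => f x * ind (fun y => ~ E y) x) = 0).
  { apply (integral_null A mu _ (fun y => ~ E y)); auto.
    - rewrite (pba_compl A) by assumption; lra.
    - intros x Hx; rewrite ind_out by assumption; ring. }
  replace (integral A mu f) with
    (integral A mu (fun x => f x * ind E x + f x * ind (fun y => ~ E y) x)).
  - rewrite integral_plus; auto using in_B_mul_ind; lra.
  - f_equal; apply functional_extensionality; intros x; rewrite ind_compl; ring.
Qed.

(** * Convex combinations of types *)

Lemma pba_conv_comb {X : Type} (A : set X -> Prop) (ti : X -> set X -> R) l :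
  (forall w, is_pba A (ti w)) -> conv_weights l -> is_pba A (conv_comb ti l).
Proof.
  intros Ht Hl; apply conv_weights_lsum in Hl; destruct Hl as [Hl0 Hl1]; split; [|split].
  - intros E G HE HG HEG; rewrite !conv_comb_lsum, <- lsum_plus.
    apply lsum_ext_in; intros p _.
    rewrite (proj1 (Ht (snd p)) E G HE HG HEG); ring.
  - intros E HE; rewrite conv_comb_lsum; apply lsum_nonneg; intros p Hp.
    apply Rmult_le_pos; auto; apply Ht, HE.
  - rewrite conv_comb_lsum, <- Hl1; apply lsum_ext_in; intros p _.
    rewrite (proj2 (proj2 (Ht (snd p)))); ring.
Qed.

(** On simple functions this is an exchange of two finite sums; the approximation errors are
    averaged by the weights and do not grow. *)
Lemma integral_conv_comb {X : Type} (A : set X -> Prop) (ti : X -> set X -> R) l f :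
  is_field A -> (forall w, is_pba A (ti w)) -> conv_weights l -> in_B A f ->
  integral A (conv_comb ti l) f = lsum l (fun p => fst p * integral A (ti (snd p)) f).
Proof.
  intros HA Ht Hl Hf; apply integral_unique; auto using pba_conv_comb.
  apply conv_weights_lsum in Hl; destruct Hl as [Hl0 Hl1].
  intros eps He; destruct (Hf eps He) as [s [Hs H]].
  exists s; split; auto; split; auto.
  assert (Hsi : simple_int (conv_comb ti l) s = lsum l (fun p => fst p * simple_int (ti (snd p)) s)).
  { rewrite simple_int_lsum.
    rewrite (lsum_ext_in s _ (fun q => lsum l (fun p => fst q * (fst p * ti (snd p) (snd q)))))
      by (intros q _; rewrite conv_comb_lsum, lsum_scal; reflexivity).
    rewrite lsum_swap; apply lsum_ext_in; intros p _.
    rewrite simple_int_lsum, <- lsum_scal; apply lsum_ext_in; intros q _; ring. }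
  assert (Hp : forall p : R * X, - eps <= integral A (ti (snd p)) f - simple_int (ti (snd p)) s <= eps).
  { intros p; pose proof (integral_approx A (ti (snd p)) f s eps HA (Ht _) Hf Hs H) as H1.
    pose proof (Rle_abs (integral A (ti (snd p)) f - simple_int (ti (snd p)) s)).
    pose proof (Rle_abs (- (integral A (ti (snd p)) f - simple_int (ti (snd p)) s))) as H2.
    rewrite Rabs_Ropp in H2; lra. }
  rewrite Hsi; apply Rabs_le.
  (* The weights sum to 1, so [eps] is its own weighted average and the bounds compare term by
     term. *)
  assert (He1 : eps = lsum l (fun p => eps * fst p)) by (rewrite lsum_scal, Hl1; ring).
  assert (He2 : - eps = lsum l (fun p => - eps * fst p)) by (rewrite lsum_scal, Hl1; ring).
  replace (lsum l (fun p => fst p * integral A (ti (snd p)) f) -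
           lsum l (fun p => fst p * simple_int (ti (snd p)) s))
    with (lsum l (fun p => fst p * (integral A (ti (snd p)) f - simple_int (ti (snd p)) s))).
  - split; [rewrite He2|rewrite He1]; apply lsum_le; intros p Hin;
      specialize (Hl0 p Hin); specialize (Hp p); nra.
  - rewrite (lsum_ext_in l _ (fun p => fst p * integral A (ti (snd p)) f +
      (-1) * (fst p * simple_int (ti (snd p)) s))) by (intros; ring).
    rewrite lsum_plus, lsum_scal; ring.
Qed.

(** * Positive functionals from convex cones *)

Definition convex_cone {X : Type} (K : (X -> R) -> Prop) : Prop :=
  (forall f g, K f -> K g -> K (fun x => f x + g x)) /\
  (forall a f, 0 <= a -> K f -> K (fun x => a * f x)).

(** Zorn's lemma gives a maximal cone [Z] without -1. If it missed both [f] and [- f], then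
    [k + a f = -1] and [k' - a' f = -1] for some [k], [k'] in [Z] and [a], [a' > 0]; the average
    with weights [a'] and [a] cancels [f] and puts -1 in [Z]. *)
Lemma maximal_cone {X : Type} (K : (X -> R) -> Prop) :
  convex_cone K -> K (fun _ => 0) -> ~ K (fun _ => -1) ->
  exists K', convex_cone K' /\ (forall f, K f -> K' f) /\ ~ K' (fun _ => -1) /\
    forall f, K' f \/ K' (fun x => - f x).
Proof.
  intros HK HK0 HK1.
  set (good := fun Z : (X -> R) -> Prop =>
    convex_cone Z /\ (forall f, K f -> Z f) /\ ~ Z (fun _ => -1)).
  (* The empty set is admitted because the union of the empty chain is empty. *)
  destruct (@classical_sets.Zorn_bigcup (X -> R) (fun Z => (forall f, ~ Z f) \/ good Z))
    as [Z [HZ Hmax]].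
  - intros F HF Htot.
    destruct (classic (exists Z f, F Z /\ Z f)) as [[Z0 [f0 [HF0 Hf0]]]|Hn].
    + right.
      assert (Hg : forall Z f, F Z -> Z f -> good Z)
        by (intros Z f HFZ Hf; destruct (HF Z HFZ) as [H|H]; [destruct (H f Hf)|exact H]).
      split; [split|split].
      * intros f g [Z1 HF1 H1] [Z2 HF2 H2].
        destruct (Htot Z1 Z2 HF1 HF2) as [H|H].
        -- exists Z2; auto; apply (proj1 (Hg Z2 g HF2 H2)); auto.
        -- exists Z1; auto; apply (proj1 (Hg Z1 f HF1 H1)); auto.
      * intros a f Ha [Z1 HF1 H1]; exists Z1; auto.
        apply (proj1 (Hg Z1 f HF1 H1)); auto.
      * intros f Hf; exists Z0; auto; apply (Hg Z0 f0 HF0 Hf0), Hf.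
      * intros [Z1 HF1 H1]; apply (proj2 (proj2 (Hg Z1 _ HF1 H1))), H1.
    + left; intros f [Z HFZ Hf]; apply Hn; exists Z, f; auto.
  (* The maximal set is not the empty one, because [K] contains 0 and would extend it properly. *)
  - assert (HgZ : good Z).
    { destruct HZ as [HZ|HZ]; auto; exfalso; apply (Hmax K).
      - split; [intros f Hf; destruct (HZ f Hf)|].
        intros H; apply (HZ _ (H _ HK0)).
      - right; split; auto. }
    destruct HgZ as [[Hadd Hsc] [HKZ HZ1]].
    exists Z; split; [split; auto|]; split; auto; split; auto.
    (* The functions [k + a f] with [0 <= a] form a cone properly larger than [Z], so by maximality
       it contains -1. Here [a = 0] is impossible, as -1 would then lie in [Z]. *)
    assert (Hext : forall f, ~ Z f ->
      exists k a, Z k /\ 0 < a /\ forall x, k x + a * f x = -1).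
    { intros f Hf.
      set (Z' := fun h => exists k a, Z k /\ 0 <= a /\ forall x, h x = k x + a * f x).
      assert (Hsub : forall h, Z h -> Z' h)
        by (intros h Hh; exists h, 0; repeat split; auto; [lra|intros; ring]).
      destruct (classic (Z' (fun _ => -1))) as [[k [a [Hk [Ha He]]]]|Hn].
      - exists k, a; split; auto; split; [|intros x; symmetry; apply He].
        destruct Ha as [Ha|Ha]; auto; exfalso; apply HZ1.
        replace (fun _ : X => -1) with k; auto.
        apply functional_extensionality; intros x; specialize (He x); rewrite <- Ha in He; lra.
      - exfalso; apply (Hmax Z').
        + split; [exact Hsub|]; intros H; apply Hf, H.
          exists (fun _ => 0), 1; split; [apply HKZ, HK0|split; [lra|intros; ring]].
        + right; split; [split|split]; auto.
          * intros h h' [k [a [Hk [Ha He]]]] [k' [a' [Hk' [Ha' He']]]].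
            exists (fun x => k x + k' x), (a + a'); split; auto; split; [lra|].
            intros x; rewrite He, He'; ring.
          * intros c h Hc [k [a [Hk [Ha He]]]].
            exists (fun x => c * k x), (c * a); split; auto; split.
            -- apply Rmult_le_pos; auto.
            -- intros x; rewrite He; ring. }
    intros f; apply NNPP; intros Hn; apply not_or_and in Hn; destruct Hn as [H1 H2].
    destruct (Hext f H1) as [k [a [Hk [Ha He]]]].
    destruct (Hext _ H2) as [k' [a' [Hk' [Ha' He']]]].
    apply HZ1.
    replace (fun _ : X => -1) with
      (fun x => / (a + a') * (a' * k x + a * k' x)).
    + apply Hsc; [left; apply Rinv_0_lt_compat; lra|].
      apply (Hadd (fun x => a' * k x) (fun x => a * k' x)); apply Hsc; auto; lra.
    + apply functional_extensionality; intros x; specialize (He x); specialize (He' x).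
      replace (k x) with (-1 - a * f x) by lra.
      replace (k' x) with (-1 + a' * f x) by lra.
      field; lra.
Qed.

(** Let [f] be below [g] when [g - f] is in the maximal cone. Constants keep their strict order
    because the cone has no negative constant, and completeness places every bounded function among
    them. This place depends linearly on the function. *)
Lemma cone_functional {X : Type} (A : set X -> Prop) (K : (X -> R) -> Prop) :
  is_field A -> convex_cone K ->
  (forall f, in_B A f -> (forall x, 0 <= f x) -> K f) -> ~ K (fun _ => -1) ->
  exists phi : (X -> R) -> R,
    (forall f g, in_B A f -> in_B A g -> phi (fun x => f x + g x) = phi f + phi g) /\
    (forall a f, in_B A f -> phi (fun x => a * f x) = a * phi f) /\
    phi (fun _ => 1) = 1 /\
    (forall f, in_B A f -> K f -> 0 <= phi f).
Proof.
  intros HA HK Hpos HK1.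
  destruct (maximal_cone K HK) as [Z [[Hadd Hsc] [HKZ [HZ1 Htot]]]]; auto.
  { apply Hpos; [apply in_B_const, HA|intros; lra]. }
  assert (Hext : forall f g, Z f -> (forall x, f x = g x) -> Z g)
    by (intros f g Hf H; replace g with f; auto; apply functional_extensionality; auto).
  assert (Hneg : forall c, c < 0 -> ~ Z (fun _ => c)).
  { intros c Hc H; apply HZ1; apply (Hext (fun _ => / (- c) * c)).
    - apply (Hsc _ (fun _ => c)); auto; left; apply Rinv_0_lt_compat; lra.
    - intros; field; lra. }
  assert (Hcst : forall c, 0 <= c -> Z (fun _ => c))
    by (intros c Hc; apply HKZ, Hpos; auto using in_B_const).
  (* [phi f] is the Dedekind cut of the constants below [f] modulo the total cone [Z]. *)
  set (cut := fun (f : X -> R) v =>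
    forall r, (r < v -> Z (fun x => f x - r)) /\ (v < r -> Z (fun x => r - f x))).
  assert (Hle : forall f v w, cut f v -> cut f w -> w <= v).
  { intros f v w Hv Hw; apply Rnot_lt_le; intros Hlt.
    (* For [v < w], the two cuts are used at the points dividing the interval into thirds; the sum
       cancels [f] and leaves the negative constant [(v - w) / 3]. *)
    apply (Hneg ((v - w) / 3)); [lra|].
    eapply Hext; [apply Hadd; [apply (proj2 (Hv (v + (w - v) / 3))); lra|
                               apply (proj1 (Hw (w - (w - v) / 3))); lra]|].
    intros x; simpl; field. }
  assert (Huniq : forall f v w, cut f v -> cut f w -> v = w)
    by (intros f v w Hv Hw; apply Rle_antisym; eapply Hle; eassumption).
  assert (Hex : forall f, in_B A f -> exists v, cut f v).
  { intros f Hf; destruct (in_B_bounded A f Hf) as [C [HC Hb]].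
    assert (Hb' : forall x, - C <= f x <= C).
    { intros x; specialize (Hb x).
      pose proof (Rle_abs (f x)) as H2; pose proof (Rle_abs (- f x)) as H1.
      rewrite Rabs_Ropp in H1; lra. }
    destruct (completeness (fun r => Z (fun x => f x - r))) as [v [Hv1 Hv2]].
    - exists C; intros r Hr; apply Rnot_lt_le; intros Hlt.
      apply (Hneg (C - r)); [lra|].
      apply (Hext (fun x => (f x - r) + (C + (-1) * f x))); [|intros; ring].
      apply Hadd; auto; apply HKZ, Hpos.
      + apply in_B_plus; [apply in_B_const, HA|apply in_B_scal, Hf].
      + intros x; specialize (Hb' x); lra.
    - exists (- C); apply HKZ, Hpos.
      + apply (in_B_plus A f (fun _ => - - C)); auto using in_B_const.
      + intros x; specialize (Hb' x); lra.
    (* Below the supremum some larger [r'] is attained, and adding the constant [r' - r] keeps the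
       function in [Z]. Above it [f - r] is not in [Z], so totality puts [r - f] there. *)
    - exists v; intros r; split; intros Hr.
      + apply NNPP; intros Hn.
        assert (v <= r); [|lra].
        apply Hv2; intros r' Hr'; apply Rnot_lt_le; intros Hlt; apply Hn.
        apply (Hext (fun x => (f x - r') + (r' - r))); [|intros; ring].
        apply (Hadd _ (fun _ => r' - r)); auto; apply Hcst; lra.
      + destruct (Htot (fun x => f x - r)) as [H|H].
        * specialize (Hv1 r H); lra.
        * apply (Hext _ _ H); intros; ring. }
  set (phi := fun f => epsilon (inhabits 0) (cut f)).
  assert (Hphi : forall f, in_B A f -> cut f (phi f))
    by (intros f Hf; apply epsilon_spec, Hex, Hf).
  assert (Heq : forall f v, cut f v -> phi f = v)
    by (intros f v Hv; apply (Huniq f); auto; apply epsilon_spec; exists v; auto).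
  assert (Hs0 : forall a f, 0 < a -> in_B A f -> phi (fun x => a * f x) = a * phi f).
  { intros a f Ha Hf; apply Heq; intros r.
    assert (Hr : r = a * (r / a)) by (field; lra).
    destruct (Hphi f Hf (r / a)) as [H1 H2]; split; intros Hlt.
    - apply (Hext (fun x => a * (f x - r / a))); [|intros; field; lra].
      apply Hsc; [lra|]; apply H1; nra.
    - apply (Hext (fun x => a * (r / a - f x))); [|intros; field; lra].
      apply Hsc; [lra|]; apply H2; nra. }
  assert (Hc : forall c, phi (fun _ => c) = c)
    by (intros c; apply Heq; intros r; split; intros Hr; apply Hcst; lra).
  assert (Hn : forall f, in_B A f -> phi (fun x => - f x) = - phi f).
  { intros f Hf; apply Heq; intros r; destruct (Hphi f Hf (- r)) as [H1 H2]; split; intros Hlt.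
    - apply (Hext (fun x => - r - f x)); [apply H2; lra|intros; ring].
    - apply (Hext (fun x => f x - - r)); [apply H1; lra|intros; ring]. }
  exists phi; split; [|split; [|split]]; auto.
  - intros f g Hf Hg; apply Heq; intros r.
    (* The gap is shared equally: [phi f - d] and [phi g - d] add up to [r], and the sign of [d]
       tells on which side of both values they lie. *)
    set (d := (phi f + phi g - r) / 2).
    destruct (Hphi f Hf (phi f - d)) as [H1 H2].
    destruct (Hphi g Hg (phi g - d)) as [H3 H4]; unfold d in *; split; intros Hlt.
    + eapply Hext; [apply (Hadd _ _ (H1 ltac:(lra)) (H3 ltac:(lra)))|intros; simpl; field].
    + eapply Hext; [apply (Hadd _ _ (H2 ltac:(lra)) (H4 ltac:(lra)))|intros; simpl; field].
  - intros a f Hf; destruct (Rtotal_order a 0) as [Ha|[Ha|Ha]].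
    + replace (fun x => a * f x) with (fun x => - (- a * f x))
        by (apply functional_extensionality; intros; ring).
      rewrite Hn by (apply in_B_scal, Hf); rewrite Hs0 by (auto; lra); ring.
    + subst a; replace (fun x => 0 * f x) with (fun _ : X => 0)
        by (apply functional_extensionality; intros; ring).
      rewrite Hc; ring.
    + auto.
  - intros f Hf HKf; apply Rnot_lt_le; intros Hlt.
    apply (Hneg (phi f / 2)); [lra|].
    apply (Hext (fun x => f x + (phi f / 2 - f x))); [|intros; ring].
    apply Hadd; auto; apply (Hphi f Hf); lra.
Qed.

(** * Separation from a bounded convex set in finite dimension *)

Lemma lsum_sqr_dist_bounded {K : Type} (l : list K) (C : (K -> R) -> Prop) :
  (forall k, In k l -> exists b, forall c, C c -> Rabs (c k) <= b) ->
  exists W, 0 <= W /\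
    forall c c', C c -> C c' -> lsum l (fun k => (c' k - c k) * (c' k - c k)) <= W.
Proof.
  induction l as [|k l IH]; intros H.
  - exists 0; split; [lra|intros; unfold lsum; simpl; lra].
  - destruct IH as [W [HW HWb]]; [intros; apply H; right; assumption|].
    destruct (H k (or_introl eq_refl)) as [b Hb].
    exists (4 * (b * b) + W); split; [nra|]; intros c c' Hc Hc'.
    change (lsum (k :: l) (fun k => (c' k - c k) * (c' k - c k))) with
      ((c' k - c k) * (c' k - c k) + lsum l (fun k => (c' k - c k) * (c' k - c k))).
    apply Rplus_le_compat; auto.
    pose proof (Hb c Hc) as H1; pose proof (Hb c' Hc') as H2.
    assert (H3 : Rabs (c' k - c k) <= 2 * b).
    { unfold Rminus; eapply Rle_trans; [apply Rabs_triang|]; rewrite Rabs_Ropp; lra. }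
    apply Rle_trans with (Rsqr (2 * b)); [|unfold Rsqr; lra].
    apply Rsqr_le_abs_1; rewrite (Rabs_pos_eq (2 * b)); auto.
    pose proof (Rabs_pos (c k)); lra.
Qed.

(* The residual [y - c] at an almost nearest point [c] of [C] is a separating direction. *)
Lemma finite_dim_separation {K : Type} (l : list K) (C : (K -> R) -> Prop) (y : K -> R) :
  (exists c, C c) ->
  (forall c c' s, C c -> C c' -> 0 <= s <= 1 -> C (fun k => (1 - s) * c k + s * c' k)) ->
  (forall k, In k l -> exists b, forall c, C c -> Rabs (c k) <= b) ->
  (forall v b, (forall c, C c -> lsum l (fun k => v k * c k) <= b) ->
     lsum l (fun k => v k * y k) <= b) ->
  forall eps, 0 < eps -> exists c, C c /\ forall k, In k l -> Rabs (y k - c k) < eps.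
Proof.
  intros [c0 Hc0] Hconv Hbd Hsep eps He; apply NNPP; intros Hn.
  set (d := fun c => lsum l (fun k => (y k - c k) * (y k - c k))).
  assert (Hd : forall c, C c -> eps * eps <= d c).
  { intros c Hc.
    assert (Hk : exists k, In k l /\ eps <= Rabs (y k - c k)).
    { apply NNPP; intros Hk; apply Hn; exists c; split; auto.
      intros k Hin; apply Rnot_le_lt; intros Hle; apply Hk; exists k; auto. }
    destruct Hk as [k [Hin Hk]].
    apply Rle_trans with ((y k - c k) * (y k - c k)).
    - change ((y k - c k) * (y k - c k)) with (Rsqr (y k - c k)).
      rewrite Rsqr_abs; unfold Rsqr; nra.
    - apply (lsum_ge_term l (fun k => (y k - c k) * (y k - c k))); auto.
      intros k' _; apply Rle_0_sqr. }
  destruct (lsum_sqr_dist_bounded l C Hbd) as [W [HW HWb]].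
  (* The infimum [D] of the squared distance is obtained as minus the supremum of [- d]. *)
  destruct (completeness (fun r => exists c, C c /\ r = - d c)) as [m [Hm1 Hm2]].
  { exists (- (eps * eps)); intros r [c [Hc ->]]; specialize (Hd c Hc); lra. }
  { exists (- d c0), c0; auto. }
  set (D := - m).
  assert (HD : 0 < D).
  { assert (m <= - (eps * eps)); [|unfold D; nra].
    apply Hm2; intros r [c [Hc ->]]; specialize (Hd c Hc); lra. }
  assert (HDl : forall c, C c -> D <= d c)
    by (intros c Hc; specialize (Hm1 _ (ex_intro _ c (conj Hc eq_refl))); unfold D; lra).
  (* Moving from [c] towards [c'] by [s] changes [d] by [-2 s (u - u0) + s^2 q] with [q <= W]. If
     [d c] exceeds [D] by less than [s^2], this forces [2 (u - u0) < s (1 + W)], and [s] is chosen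
     so that the right side is at most [D]. *)
  set (s := Rmin 1 (D / (1 + W))).
  assert (Hs : 0 < s) by (apply Rmin_glb_lt; [lra|apply Rdiv_lt_0_compat; lra]).
  assert (Hs1 : s <= 1) by apply Rmin_l.
  assert (HsW : s * (1 + W) <= D).
  { apply Rle_trans with (D / (1 + W) * (1 + W)); [|right; field; lra].
    apply Rmult_le_compat_r; [lra|apply Rmin_r]. }
  assert (Hc : exists c, C c /\ d c < D + s * s).
  { apply NNPP; intros Hc.
    assert (m <= m - s * s); [|nra].
    apply Hm2; intros r [c [HCc ->]].
    assert (~ d c < D + s * s) by (intros H; apply Hc; exists c; auto).
    unfold D in *; lra. }
  destruct Hc as [c [Hc Hdc]].
  set (v := fun k => y k - c k).
  assert (Hb : forall c', C c' ->
            lsum l (fun k => v k * c' k) <= lsum l (fun k => v k * c k) + D / 2).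
  { intros c' Hc'.
    pose proof (HDl _ (Hconv c c' s Hc Hc' ltac:(lra))) as H1.
    assert (H2 : d (fun k => (1 - s) * c k + s * c' k) =
      d c + (-2 * s) * (lsum l (fun k => v k * c' k) + (-1) * lsum l (fun k => v k * c k))
      + (s * s) * lsum l (fun k => (c' k - c k) * (c' k - c k))).
    { unfold d; rewrite <- !lsum_scal, <- lsum_plus, <- !lsum_scal, <- !lsum_plus.
      apply lsum_ext_in; intros k _; unfold v; ring. }
    specialize (HWb c c' Hc Hc'); rewrite H2 in H1.
    set (q := lsum l (fun k => (c' k - c k) * (c' k - c k))) in *.
    set (u := lsum l (fun k => v k * c' k)) in *.
    set (u0 := lsum l (fun k => v k * c k)) in *.
    assert (H3 : (s * s) * q <= (s * s) * W) by (apply Rmult_le_compat_l; nra).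
    assert (H4 : s * (2 * (u - u0)) < s * (s * (1 + W))) by nra.
    apply Rmult_lt_reg_l in H4; auto; lra. }
  (* The half-space condition passes to [y]. Since [v = y - c], the squared distance [d c] is then
     at most [D / 2], although it is at least [D > 0]. *)
  specialize (Hsep v _ Hb).
  assert (H5 : d c = lsum l (fun k => v k * y k) + (-1) * lsum l (fun k => v k * c k)).
  { unfold d; rewrite <- lsum_scal, <- lsum_plus.
    apply lsum_ext_in; intros k _; unfold v; ring. }
  specialize (HDl c Hc); lra.
Qed.

(** * Type spaces *)

(** The type at [w] is certain of whichever of [E] and its complement contains [w]. *)
Lemma type_measurable_ind {Om N : Type} (A : set Om -> Prop) M
  (t : N -> Om -> set Om -> R) i E w :
  is_type_space A M t -> M i E -> t i w E = ind E w.
Proof.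
  intros [HA [HM [Ht [_ Hc]]]] HE; destruct (classic (E w)) as [Hw|Hw].
  - rewrite ind_in by assumption; apply Hc; assumption.
  - rewrite ind_out by assumption; destruct (HM i) as [HF Hs].
    assert (H : t i w (fun x => ~ E x) = 1) by (apply Hc; [apply HF, HE|exact Hw]).
    rewrite (pba_compl A) in H; auto; lra.
Qed.

(** For simple [f] the expectation is a finite combination of functions [t i _ E], which are in [B]
    for [M i]. Uniform approximation of [f] approximates the expectation uniformly with the same
    error. *)
Lemma expectation_in_B {Om N : Type} (A : set Om -> Prop) M
  (t : N -> Om -> set Om -> R) i f :
  is_type_space A M t -> in_B A f -> in_B (M i) (fun w => integral A (t i w) f).
Proof.
  intros [HA [HM [Ht [HB _]]]] Hf; apply in_B_of_approx; intros eps He.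
  destruct (Hf eps He) as [s [Hs H]].
  exists (fun w => lsum s (fun p => fst p * t i w (snd p))); split.
  - apply (in_B_lsum (M i) s (fun p w => fst p * t i w (snd p))); [apply HM|].
    intros p Hp; apply (in_B_scal (M i) (fst p) (fun w => t i w (snd p))), HB, Hs, Hp.
  - intros w; rewrite <- simple_int_lsum; apply integral_approx; auto.
Qed.

Lemma integral_type_measurable {Om N : Type} (A : set Om -> Prop) M
  (t : N -> Om -> set Om -> R) i g w :
  is_type_space A M t -> in_B (M i) g -> integral A (t i w) g = g w.
Proof.
  intros HT Hg; pose proof HT as [HA [HM [Ht _]]].
  apply integral_unique; auto; intros eps He.
  destruct (Hg eps He) as [s [Hs H]]; exists s; split; [|split; auto].
  - intros p Hp; apply (proj2 (HM i)), Hs, Hp.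
  - rewrite simple_int_lsum.
    rewrite (lsum_ext_in s _ (fun p => fst p * ind (snd p) w)).
    + rewrite <- simple_eval_lsum; apply H.
    + intros p Hp; rewrite (type_measurable_ind A M) by auto; reflexivity.
Qed.

(** Since [g] is measurable for [M i], its integral against [t i w] is [g w], the integral of [f]
    against [t i w]. So [f] and [g] have equal integrals under every convex combination of types,
    and testing weak* closeness on the pair [f], [g] carries this to [P]. *)
Lemma Pi_iterated_integral {Om N : Type} (A : set Om -> Prop) M
  (t : N -> Om -> set Om -> R) i P f :
  is_type_space A M t -> Pi A t i P -> in_B A f ->
  integral A P f = integral A P (fun w => integral A (t i w) f).
Proof.
  intros HT [_ HP] Hf; pose proof HT as [HA [HM [Ht _]]].
  set (g := fun w => integral A (t i w) f).
  assert (HgM : in_B (M i) g) by (apply (expectation_in_B A M t i f HT Hf)).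
  assert (Hg : in_B A g) by (apply (in_B_sub A (M i)); [apply HM|exact HgM]).
  apply cond_eq; intros eps He.
  destruct (HP (f :: g :: nil) (eps / 2)) as [l [Hl H]]; [lra| |].
  { intros h [<-|[<-|[]]]; auto. }
  pose proof (H f (or_introl eq_refl)) as H1.
  pose proof (H g (or_intror (or_introl eq_refl))) as H2.
  assert (H3 : integral A (conv_comb (t i) l) f = integral A (conv_comb (t i) l) g).
  { rewrite !integral_conv_comb by auto; apply lsum_ext_in; intros p _.
    rewrite (integral_type_measurable A M t i g) by auto; reflexivity. }
  rewrite H3 in H1.
  replace (integral A P f - integral A P g) with
    ((integral A P f - integral A (conv_comb (t i) l) g) +
     - (integral A P g - integral A (conv_comb (t i) l) g)) by ring.
  eapply Rle_lt_trans; [apply Rabs_triang|]; rewrite Rabs_Ropp; lra.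
Qed.

(** * Consistency excludes agreeable bets *)

Lemma consistent_no_agreeable_bet {Om N : Type} (A : set Om -> Prop) M
  (t : N -> Om -> set Om -> R) I f :
  is_type_space A M t -> universally_consistent A t -> ~ weakly_agreeable A t I f.
Proof.
  intros HT HU [[HI [_ [Hf Hsum]]] [Hall [w [alpha [Ha [S [HS [_ HSE]]]]]]]].
  pose proof HT as [HA [HM [Ht _]]].
  destruct (HU I S HS) as [P [HP [HPi [c [Hc HcE]]]]].
  assert (Hpos : forall i, In i I -> alpha / 2 * c <= integral A P (f i)).
  { intros i Hi; rewrite (Pi_iterated_integral A M t i) by auto.
    set (g := fun w => integral A (t i w) (f i)).
    assert (HgM : in_B (M i) g) by (apply (expectation_in_B A M t i); auto).
    assert (Hg : in_B A g) by (apply (in_B_sub A (M i)); [apply HM|exact HgM]).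
    (* On [S] the expectation [g] is at least [alpha], so [F] contains [S] and has probability at
       least [c], while [g] still exceeds [alpha / 2] on all of [F]. *)
    destruct (in_B_level_separation (M i) g (alpha / 2) alpha) as [F [HF [HF1 HF2]]];
      [apply HM|exact HgM|lra|].
    assert (HFA : A F) by (apply (proj2 (HM i)), HF).
    assert (HPF : c <= P F) by (apply HcE; auto; intros x Hx; apply HF1, HSE; auto).
    apply Rle_trans with (integral A P (fun x => alpha / 2 * ind F x)).
    - rewrite integral_scal, integral_ind; auto using in_B_ind.
      apply Rmult_le_compat_l; lra.
    - apply integral_le; auto using in_B_scal, in_B_ind; intros x.
      destruct (classic (F x)) as [Hx|Hx].
      + rewrite ind_in by assumption; specialize (HF2 x Hx); lra.
      (* Outside [F] the bound is the nonnegativity required everywhere of a weakly agreeable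
         bet. *)
      + rewrite ind_out by assumption; rewrite Rmult_0_r.
        destruct (Hall x) as [S' [_ [Hx' H']]]; apply (H' x Hx' i Hi). }
  assert (H0 : lsum I (fun i => integral A P (f i)) = 0).
  { rewrite <- (integral_lsum A P I f) by auto.
    rewrite <- (integral_const A P 0) by auto.
    f_equal; apply functional_extensionality; exact Hsum. }
  destruct I as [|i0 I]; [tauto|].
  pose proof (lsum_le (i0 :: I) _ _ Hpos) as H1.
  rewrite lsum_const, H0 in H1.
  assert (H2 : 0 < INR (length (i0 :: I))) by (apply lt_0_INR; simpl; apply Nat.lt_0_succ).
  assert (0 < alpha / 2 * c) by (apply Rmult_lt_0_compat; lra).
  nra.
Qed.

(** The gap between [g w] and [b] is realized by a set of [M i] that contains [E] but not [w]; the
    type at [w] gives this set probability 0. *)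
Lemma type_null_below_level {Om N : Type} (A : set Om -> Prop) M
  (t : N -> Om -> set Om -> R) i g E b w :
  is_type_space A M t -> A E -> in_B (M i) g -> (forall x, E x -> b <= g x) ->
  g w < b -> t i w E = 0.
Proof.
  intros HT HE Hg Hb Hw; pose proof HT as [HA [HM [Ht _]]].
  destruct (in_B_level_separation (M i) g (g w) b) as [F [HF [HF1 HF2]]]; auto; [apply HM|].
  apply Rle_antisym; [|apply Ht, HE].
  apply Rle_trans with (t i w F).
  - apply (pba_mono A); auto; apply (proj2 (HM i)), HF.
  - rewrite (type_measurable_ind A M) by auto.
    rewrite ind_out; [lra|]; intros H; specialize (HF2 w H); lra.
Qed.

Lemma agreeable_bet_of_component {Om N : Type} (A : set Om -> Prop) M
  (t : N -> Om -> set Om -> R) J S E h :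
  is_type_space A M t -> J <> nil -> NoDup J -> (exists w, S w) ->
  A E -> (forall w, E w -> S w) -> (forall w i, S w -> In i J -> t i w E = 1) ->
  (forall i, In i J -> in_B A (h i)) ->
  (forall i w, In i J -> E w -> 0 <= integral A (t i w) (h i)) ->
  (forall w, lsum J (fun i => h i w) = -1) ->
  exists f, weakly_agreeable A t J f.
Proof.
  intros HT HJ HJd [w0 Hw0] HE HES HS1 Hh Hh0 Hsum.
  pose proof HT as [HA [HM [Ht _]]].
  (* Adding [b] for each of the [length J] players raises the total from -1 to 0. *)
  set (b := / INR (length J)).
  assert (Hn : 0 < INR (length J)).
  { apply lt_0_INR; destruct J; [tauto|simpl; apply Nat.lt_0_succ]. }
  assert (Hb : 0 < b) by (apply Rinv_0_lt_compat, Hn).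
  (* Truncation to [E] changes no expectation for a type certain of [E] and makes it 0 for a type
     that gives [E] probability 0. *)
  set (f := fun i x => (h i x + b) * ind E x).
  assert (Hhb : forall i, In i J -> in_B A (fun x => h i x + b))
    by (intros i Hi; apply in_B_plus; auto using in_B_const).
  assert (Hf : forall i, In i J -> in_B A (f i))
    by (intros i Hi; apply in_B_mul_ind; auto).
  assert (HfE : forall i w, In i J -> E w -> b <= integral A (t i w) (f i)).
  { intros i w Hi Hw; unfold f; rewrite integral_mul_ind_full by auto.
    rewrite integral_plus, integral_const by auto using in_B_const.
    specialize (Hh0 i w Hi Hw); lra. }
  assert (Hcase : forall i w, In i J ->
    b <= integral A (t i w) (f i) \/ (t i w E = 0 /\ integral A (t i w) (f i) = 0)).
  { intros i w Hi; destruct (Rle_lt_dec b (integral A (t i w) (f i))) as [H|H]; auto.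
    right; assert (H0 : t i w E = 0).
    { apply (type_null_below_level A M t i (fun w => integral A (t i w) (f i)) E b); auto.
      apply (expectation_in_B A M t i); auto. }
    split; auto; apply (integral_null A _ _ E); auto.
    intros x Hx; unfold f; rewrite ind_out by assumption; ring. }
  exists f; split; [|split].
  - split; [exact HJ|]; split; [exact HJd|]; split; [exact Hf|].
    intros w; change (lsum J (fun i => f i w) = 0); unfold f.
    rewrite (lsum_ext_in J _ (fun i => ind E w * (h i w + b))) by (intros; ring).
    rewrite lsum_scal, lsum_plus, lsum_const, Hsum; unfold b; field; lra.
  (* The expectations are nonnegative at every point, so the whole space serves as the component. *)
  - intros w; exists (fun _ => True); split; [|split; auto].
    + split; [exists w; exact I|]; exists (fun _ => True); split; [apply HA|split; auto].
      intros w' i _ _; apply (Ht i w').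
    + intros x _ i Hi; destruct (Hcase i x Hi) as [H|[_ H]]; lra.
  - exists w0, b; split; auto; exists S; split; [|split; auto].
    + split; [exists w0; auto|]; exists E; auto.
    (* On [S] every type is certain of [E], which excludes the null case. *)
    + intros x Hx i Hi; destruct (Hcase i x Hi) as [H|[H _]]; auto.
      rewrite (HS1 x i Hx Hi) in H; lra.
Qed.

(** * Positive functionals as finitely additive probabilities *)

Lemma functional_lsum {X K : Type} (A : set X -> Prop) (phi : (X -> R) -> R)
  (l : list K) (v : K -> R) (F : K -> X -> R) :
  is_field A ->
  (forall f g, in_B A f -> in_B A g -> phi (fun x => f x + g x) = phi f + phi g) ->
  (forall a f, in_B A f -> phi (fun x => a * f x) = a * phi f) ->
  (forall k, In k l -> in_B A (F k)) ->
  phi (fun x => lsum l (fun k => v k * F k x)) = lsum l (fun k => v k * phi (F k)).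
Proof.
  intros HA Hadd Hsc; induction l as [|k l IH]; intros HF.
  - change (phi (fun _ => 0) = 0).
    pose proof (Hsc 0 (fun _ => 0) (in_B_const A 0 HA)) as H.
    cbv beta in H; replace (fun _ : X => 0 * 0) with (fun _ : X => 0) in H
      by (apply functional_extensionality; intros; ring); lra.
  - change (phi (fun x => v k * F k x + lsum l (fun k => v k * F k x)) =
      v k * phi (F k) + lsum l (fun k => v k * phi (F k))).
    assert (Hk : in_B A (F k)) by (apply HF; left; reflexivity).
    assert (Hl : forall k', In k' l -> in_B A (F k')) by (intros; apply HF; right; assumption).
    rewrite (Hadd (fun x => v k * F k x) (fun x => lsum l (fun k => v k * F k x))).
    + rewrite Hsc, IH by auto; reflexivity.
    + apply in_B_scal, Hk.
    + apply (in_B_lsum A l (fun k x => v k * F k x)); auto.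
      intros k' Hk'; apply in_B_scal; auto.
Qed.

Lemma functional_pba {X : Type} (A : set X -> Prop) (phi : (X -> R) -> R) :
  is_field A ->
  (forall f g, in_B A f -> in_B A g -> phi (fun x => f x + g x) = phi f + phi g) ->
  phi (fun _ => 1) = 1 ->
  (forall f, in_B A f -> (forall x, 0 <= f x) -> 0 <= phi f) ->
  is_pba A (fun E => phi (ind E)).
Proof.
  intros HA Hadd H1 Hpos; split; [|split].
  - intros E G HE HG HEG; rewrite <- Hadd by auto using in_B_ind.
    f_equal; apply functional_extensionality; intros x; apply ind_disjoint_union, HEG.
  - intros E HE; apply Hpos; auto using in_B_ind; apply ind_range.
  - rewrite <- H1; f_equal; apply functional_extensionality; intros x; apply ind_in; exact I.
Qed.

(** Linearity gives agreement on simple functions. Positivity and [phi 1 = 1] bound the change of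
    [phi] by the uniform distance, so agreement extends to [B]. *)
Lemma functional_integral {X : Type} (A : set X -> Prop) (phi : (X -> R) -> R) f :
  is_field A ->
  (forall f g, in_B A f -> in_B A g -> phi (fun x => f x + g x) = phi f + phi g) ->
  (forall a f, in_B A f -> phi (fun x => a * f x) = a * phi f) ->
  phi (fun _ => 1) = 1 ->
  (forall f, in_B A f -> (forall x, 0 <= f x) -> 0 <= phi f) ->
  in_B A f -> integral A (fun E => phi (ind E)) f = phi f.
Proof.
  intros HA Hadd Hsc H1 Hpos Hf.
  apply integral_unique; auto using functional_pba.
  intros eps He; destruct (Hf eps He) as [s [Hs H]]; exists s; split; auto; split; auto.
  assert (Hes : in_B A (simple_eval s)) by (apply in_B_simple, Hs).
  replace (simple_int (fun E => phi (ind E)) s) with (phi (simple_eval s)).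
  - assert (Hbd : forall g, in_B A g -> (forall x, - eps <= g x) -> - eps <= phi g).
    { intros g Hg Hge.
      assert (H0 : 0 <= phi (fun x => g x + eps * 1)).
      { apply Hpos; [apply in_B_plus; auto using in_B_const|].
        intros x; specialize (Hge x); lra. }
      rewrite (Hadd g (fun _ => eps * 1)), (Hsc eps (fun _ => 1)), H1 in H0
        by auto using in_B_const; lra. }
    assert (Hx : forall x, - eps <= f x - simple_eval s x <= eps).
    { intros x; specialize (H x).
      pose proof (Rle_abs (f x - simple_eval s x)) as H2.
      pose proof (Rle_abs (- (f x - simple_eval s x))) as H3.
      rewrite Rabs_Ropp in H3; lra. }
    apply Rabs_le; split.
    + assert (H2 := Hbd (fun x => f x + (-1) * simple_eval s x)).
      rewrite Hadd, Hsc in H2 by auto using in_B_scal.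
      assert (- eps <= phi f + -1 * phi (simple_eval s)); [|lra].
      apply H2; [auto using in_B_plus, in_B_scal|]; intros x; specialize (Hx x); lra.
    + assert (H2 := Hbd (fun x => simple_eval s x + (-1) * f x)).
      rewrite Hadd, Hsc in H2 by auto using in_B_scal.
      assert (- eps <= phi (simple_eval s) + -1 * phi f); [|lra].
      apply H2; [auto using in_B_plus, in_B_scal|]; intros x; specialize (Hx x); lra.
  - rewrite simple_int_lsum.
    rewrite <- (functional_lsum A phi s fst (fun p => ind (snd p))); auto.
    + f_equal; apply functional_extensionality; intros x; apply simple_eval_lsum.
    + intros p Hp; apply in_B_ind, Hs, Hp.
Qed.

(** For finitely many test functions, the integrals under convex combinations of types form a
    bounded convex set. A half-space containing it, with normal [v] and bound [b], says that
    [b - sum v f] has nonnegative expectation under every type. By domination the integrals under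
    [P] lie in the same half-space, and separation puts them in the closure. *)
Lemma Pi_of_dominated {Om N : Type} (A : set Om -> Prop) M
  (t : N -> Om -> set Om -> R) i P :
  is_type_space A M t -> is_pba A P ->
  (forall f, in_B A f -> (forall w, 0 <= integral A (t i w) f) -> 0 <= integral A P f) ->
  Pi A t i P.
Proof.
  intros HT HP Hdom; pose proof HT as [HA [HM [Ht _]]]; split.
  { split; [|apply HP]; exists 1; intros E HE.
    rewrite Rabs_pos_eq; [apply (pba_le1 A); auto|apply HP, HE]. }
  intros fs eps He Hfs.
  (* A space of total mass 1 is not empty; any point supplies a first element of the convex set. *)
  assert (Hw : exists w : Om, True).
  { apply NNPP; intros Hn; assert (H := pba_empty A P HA HP).
    destruct HP as [_ [_ H1]].
    rewrite (set_ext (fun _ : Om => False) (fun _ => True)) in H; [lra|].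
    intros x; destruct Hn; exists x; exact I. }
  destruct Hw as [w0 _].
  (* The coordinates are indexed by the test functions themselves. Equality is asked only on [in_B],
     since elsewhere [integral] is an arbitrary choice and mixtures could not be computed. *)
  set (C := fun c : (Om -> R) -> R => exists l, conv_weights l /\
    forall f, in_B A f -> c f = integral A (conv_comb (t i) l) f).
  assert (Hpt : forall w, C (integral A (t i w))).
  { intros w; exists ((1, w) :: nil).
    assert (Hl : conv_weights ((1, w) :: nil)).
    { apply conv_weights_lsum; split; [intros p [<-|[]]; simpl; lra|unfold lsum; simpl; ring]. }
    split; auto; intros f Hf; rewrite integral_conv_comb by auto.
    unfold lsum; simpl; ring. }
  destruct (finite_dim_separation fs C (integral A P)) with (eps := eps) as [c [[l [Hl Hc]] H]]; auto.
  - exists (integral A (t i w0)); auto.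
  - intros c c' s [l [Hl Hc]] [l' [Hl' Hc']] Hs.
    set (sc := fun (a : R) => map (fun p : R * Om => (a * fst p, snd p))).
    exists (sc (1 - s) l ++ sc s l').
    pose proof (proj1 (conv_weights_lsum l) Hl) as [Hl0 Hl1].
    pose proof (proj1 (conv_weights_lsum l') Hl') as [Hl0' Hl1'].
    assert (Hw : conv_weights (sc (1 - s) l ++ sc s l')).
    { apply conv_weights_lsum; split.
      - intros p Hp; apply in_app_or in Hp; destruct Hp as [Hp|Hp];
          apply in_map_iff in Hp; destruct Hp as [q [<- Hq]]; simpl;
          apply Rmult_le_pos; auto; lra.
      - unfold sc; rewrite lsum_app, !lsum_map; simpl; rewrite !lsum_scal.
        change (fun k : R * Om => fst k) with (@fst R Om); rewrite Hl1, Hl1'; ring. }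
    split; auto; intros f Hf; rewrite Hc, Hc', !integral_conv_comb by auto.
    unfold sc; rewrite lsum_app, !lsum_map, <- !lsum_scal.
    f_equal; apply lsum_ext_in; intros p _; simpl; ring.
  - intros f Hf; destruct (in_B_bounded A f (Hfs f Hf)) as [b [_ Hb]].
    exists b; intros c [l [Hl Hc]]; rewrite Hc by auto.
    apply integral_abs_le; auto using pba_conv_comb.
  - intros v b Hv.
    assert (HB : in_B A (fun x => lsum fs (fun f => v f * f x))).
    { apply (in_B_lsum A fs (fun f x => v f * f x)); auto.
      intros f Hf; apply in_B_scal; auto. }
    assert (Hlin : forall mu, is_pba A mu ->
      integral A mu (fun x => b + (-1) * lsum fs (fun f => v f * f x)) =
      b - lsum fs (fun f => v f * integral A mu f)).
    { intros mu Hmu.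
      rewrite integral_plus, integral_scal, integral_const
        by auto using in_B_const, in_B_scal.
      rewrite (functional_lsum A (integral A mu) fs v (fun f => f)); auto.
      - ring.
      - intros; apply integral_plus; auto.
      - intros; apply integral_scal; auto. }
    assert (H0 : 0 <= integral A P (fun x => b + (-1) * lsum fs (fun f => v f * f x))).
    { apply Hdom.
      - apply in_B_plus; auto using in_B_const, in_B_scal.
      - intros w; rewrite Hlin by auto.
        specialize (Hv _ (Hpt w)); lra. }
    rewrite Hlin in H0 by auto; lra.
  - exists l; split; auto; intros f Hf; rewrite <- Hc by auto; auto.
Qed.

(** * From a component to a common prior or a bet *)

Lemma component_dichotomy {Om N : Type} (A : set Om -> Prop) M
  (t : N -> Om -> set Om -> R) J S :
  is_type_space A M t -> J <> nil -> NoDup J -> cc_component A t J S ->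
  (exists P, is_pba A P /\ (forall i, In i J -> Pi A t i P) /\
     exists c, 0 < c /\ forall E, A E -> (forall w, S w -> E w) -> c <= P E) \/
  exists f, weakly_agreeable A t J f.
Proof.
  intros HT HJ HJd [HS [E [HE [HES HS1]]]]; pose proof HT as [HA [HM [Ht _]]].
  (* Expectations are constrained only on [E]. This makes the cone large enough for a functional
     positive on it to give [E] full mass. *)
  set (K := fun h : Om -> R => exists hs : N -> Om -> R,
    (forall i, In i J -> in_B A (hs i)) /\
    (forall i w, In i J -> E w -> 0 <= integral A (t i w) (hs i)) /\
    (forall w, h w = lsum J (fun i => hs i w))).
  destruct (classic (K (fun _ => -1))) as [[h [Hh1 [Hh2 Hh3]]]|HK1].
  { right; apply (agreeable_bet_of_component A M t J S E h); auto. }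
  left.
  assert (HKi : forall i h, In i J -> in_B A h ->
            (forall w, E w -> 0 <= integral A (t i w) h) -> K h).
  { intros i h Hi Hh H0.
    exists (fun j w => if excluded_middle_informative (j = i) then h w else 0).
    split; [|split].
    - intros j _; destruct (excluded_middle_informative (j = i)); auto using in_B_const.
    - intros j w _ Hw; destruct (excluded_middle_informative (j = i)) as [->|_]; auto.
      rewrite integral_const by auto; lra.
    - intros w; rewrite (lsum_single J i (h w)) by auto; reflexivity. }
  assert (HKcone : convex_cone K).
  { split.
    - intros f g [fs [Hf1 [Hf2 Hf3]]] [gs [Hg1 [Hg2 Hg3]]].
      exists (fun i x => fs i x + gs i x); split; [|split].
      + intros i Hi; apply in_B_plus; auto.
      + intros i w Hi Hw; rewrite integral_plus by auto.
        specialize (Hf2 i w Hi Hw); specialize (Hg2 i w Hi Hw); lra.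
      + intros w; rewrite lsum_plus, Hf3, Hg3; reflexivity.
    - intros a f Ha [fs [Hf1 [Hf2 Hf3]]].
      exists (fun i x => a * fs i x); split; [|split].
      + intros i Hi; apply in_B_scal; auto.
      + intros i w Hi Hw; rewrite integral_scal by auto; apply Rmult_le_pos; auto.
      + intros w; rewrite lsum_scal, Hf3; reflexivity. }
  assert (Hi0 : exists i0, In i0 J)
    by (destruct J as [|i0 J]; [tauto|exists i0; left; reflexivity]).
  destruct Hi0 as [i0 Hi0].
  assert (HKpos : forall f, in_B A f -> (forall x, 0 <= f x) -> K f)
    by (intros f Hf H; apply (HKi i0); auto; intros; apply integral_nonneg; auto).
  destruct (cone_functional A K HA HKcone HKpos HK1) as [phi [Hadd [Hsc [H1 HphiK]]]].
  assert (Hpos : forall f, in_B A f -> (forall x, 0 <= f x) -> 0 <= phi f) by auto.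
  assert (HP : is_pba A (fun E => phi (ind E))) by (apply functional_pba; auto).
  exists (fun E => phi (ind E)); split; auto; split.
  - intros i Hi; apply (Pi_of_dominated A M); auto.
    intros f Hf H0; rewrite functional_integral by auto.
    apply HphiK; auto; apply (HKi i); auto.
  - assert (HEc : A (fun x => ~ E x)) by (apply HA, HE).
    (* Types at points of [E] give the complement of [E] probability 0, so minus its indicator is in
       [K]; positivity of [phi] then makes the complement null. *)
    assert (H0 : 0 <= phi (fun x => -1 * ind (fun y => ~ E y) x)).
    { apply HphiK; [apply in_B_scal, in_B_ind, HEc|].
      apply (HKi i0); auto; [apply in_B_scal, in_B_ind, HEc|]; intros w Hw.
      rewrite integral_scal, integral_ind by auto using in_B_ind.
      rewrite (pba_compl A), HS1 by auto; lra. }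
    rewrite Hsc in H0 by auto using in_B_ind.
    pose proof (pba_compl A _ E HA HP HE) as H2; simpl in H2.
    (* Every set that contains [S] contains [E], which has probability 1. *)
    exists 1; split; [lra|]; intros F HF HSF.
    apply Rle_trans with (phi (ind E)); [lra|].
    apply (pba_mono A (fun E => phi (ind E)) E F); auto.
Qed.

Lemma pba_dirac {X : Type} (A : set X -> Prop) (w : X) : is_pba A (fun E => ind E w).
Proof.
  split; [|split].
  - intros E G _ _ HEG; apply ind_disjoint_union, HEG.
  - intros E _; apply ind_range.
  - apply ind_in; exact I.
Qed.

Theorem theorem4 (Om N : Type) (A : set Om -> Prop) (M : N -> set Om -> Prop)
  (t : N -> Om -> set Om -> R)
  (HN : inhabited N) (HT : is_type_space A M t) :
  (universally_consistent A t \/ exists I f, weakly_agreeable A t I f) /\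
  ~ (universally_consistent A t /\ exists I f, weakly_agreeable A t I f).
Proof.
  split.
  - destruct (classic (exists I f, weakly_agreeable A t I f)) as [H|Hn]; [right; exact H|left].
    intros I S HS.
    (* Consistency ranges over lists with possible repetitions, whereas the players of a bet are
       listed once. *)
    set (J := nodup (fun i j => excluded_middle_informative (i = j)) I).
    assert (HIJ : forall i, In i I <-> In i J) by (intros i; symmetry; apply nodup_In).
    destruct HS as [[w Hw] [E [HE [HES HS1]]]].
    (* A bet has at least one player, so the empty list is treated apart: there the point mass at a
       point of [S] is the required probability. *)
    destruct (classic (J = nil)) as [HJ|HJ].
    + exists (fun E => ind E w); split; [apply pba_dirac|split].
      * intros i Hi; apply HIJ in Hi; rewrite HJ in Hi; destruct Hi.
      * exists 1; split; [lra|]; intros F _ HF; rewrite ind_in by auto; lra.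
    + destruct (component_dichotomy A M t J S HT HJ) as [[P [HP [HPi Hc]]]|[f Hf]].
      * apply NoDup_nodup.
      * split; [exists w; auto|]; exists E; split; auto; split; auto.
        intros w' i Hw' Hi; apply HS1; auto; apply HIJ, Hi.
      * exists P; split; auto; split; auto; intros i Hi; apply HPi, HIJ, Hi.
      * destruct Hn; exists J, f; exact Hf.
  - intros [HU [I [f Hf]]]; exact (consistent_no_agreeable_bet A M t I f HT HU Hf).
Qed.
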